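(* Let $G$ be a finite simple graph without isolated vertices with $\alpha(G)\geqslant 3$ which is not a join of two proper subgraphs. Then $G$ is a locally triangle-free graph in $W_2$ if and only if $G$ is a triangle-free graph in $W_2$, or $G$ is isomorphic to one of $Q_9$, $Q_{12}$, $P_{10}$, $P_{12}$.
   Context: An independent set is a set of pairwise non-adjacent vertices; $\alpha(G)$ is the maximum size of one. $G$ is well-covered if all maximal independent sets have the same size; a well-covered $G$ is in $W_2$ if removing any vertex leaves a well-covered graph with the same independence number. For $S\subseteq V(G)$, $N_G[S]$ is $S$ together with all vertices adjacent to some vertex of $S$, and $G_S=G\setminus N_G[S]$ (induced subgraph); $G_v=G_{\{v\}}$. $G$ is locally triangle-free if $G_v$ is triangle-free for every vertex $v$. The join $G_1*G_2$ of vertex-disjoint graphs has vertex set $V(G_1)\cup V(G_2)$ and edges $E(G_1)\cup E(G_2)\cup\{uv: u\in V(G_1),v\in V(G_2)\}$; $G$ is a join of two proper subgraphs if $G=G_1*G_2$ with $G_1,G_2$ nonempty. $Q_9$: vertices $a,b,c,a_1,a_2,b_1,b_2,c_1,c_2$; edges $ab,bc,ca,aa_1,aa_2,bb_1,bb_2,cc_1,cc_2,a_1c_1,c_1b_1,b_1a_2,a_2c_2,c_2b_2,b_2a_1$. $Q_{12}$: vertices $a,b,c,a_i,b_i,c_i$ ($i=1,2,3$); edges $ab,bc,ca$, $aa_i,bb_i,cc_i$ ($i=1,2,3$), and $a_1c_1,c_1b_1,b_1a_3,a_3c_3,c_3b_3,b_3a_2,a_2c_2,c_2b_2,b_2a_1$.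 $P_{10}$: vertices $a,b,c,x,y,a_1,b_1,b_2,c_1,c_2$; edges $ab,ac,aa_1,ax,ay,bc,bb_1,bb_2,cc_1,cc_2,xy,xb_2,xc_1,yb_1,yc_2,a_1b_1,a_1b_2,a_1c_1,a_1c_2,b_1c_1,b_2c_2$. $P_{12}$: vertices $a,b,c,d,x,y,z,t,a_1,b_1,c_1,c_2$; edges $ab,aa_1,ac,ad,ax,ay,bb_1,bc,bd,bt,bz,cx,cz,cc_1,cc_2,dy,dt,dc_1,dc_2,a_1b_1,a_1z,a_1t,a_1c_1,a_1c_2,b_1x,b_1y,b_1c_1,b_1c_2,xy,xt,xc_1,yz,yc_2,zt,zc_1,tc_2$. *)

(* Defs.v *)
From mathcomp Require Import all_boot.

Set Implicit Arguments.
Unset Strict Implicit.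
Unset Printing Implicit Defensive.

Record sgraph := SGraph {
  vertex :> finType;
  adj : rel vertex;
  adj_sym : symmetric adj;
  adj_irr : irreflexive adj
}.

Definition isomorphic (G H : sgraph) : Prop :=
  exists f : G -> H, bijective f /\ forall x y, adj (f x) (f y) = adj x y.

Section Induced.
Variables (G : sgraph) (A : {set G}).

Definition induced_adj : rel {x : G | x \in A} :=
  fun x y => adj (val x) (val y).

Lemma induced_adj_sym : symmetric induced_adj.
Proof. by move=> x y; apply: adj_sym. Qed.

Lemma induced_adj_irr : irreflexive induced_adj.
Proof. by move=> x; apply: adj_irr. Qed.

Definition induced : sgraph := SGraph induced_adj_sym induced_adj_irr.
End Induced.

Section Join.
Variables G1 G2 : sgraph.

Definition join_adj : rel (G1 + G2)%type := fun u v =>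
  match u, v with
  | inl x, inl y => adj x y
  | inr x, inr y => adj x y
  | _, _ => true
  end.

Lemma join_adj_sym : symmetric join_adj.
Proof. by move=> [x|x] [y|y] //=; apply: adj_sym. Qed.

Lemma join_adj_irr : irreflexive join_adj.
Proof. by move=> [x|x] /=; apply: adj_irr. Qed.

Definition join : sgraph := SGraph join_adj_sym join_adj_irr.
End Join.

Definition is_proper_join (G : sgraph) : Prop :=
  exists G1 G2 : sgraph, [/\ 0 < #|G1|, 0 < #|G2| & isomorphic G (join G1 G2)].

Definition no_isolated_vertex (G : sgraph) : Prop :=
  forall x : G, exists y : G, adj x y.

Definition independent (G : sgraph) (S : {set G}) : bool :=
  [forall x in S, forall y in S, ~~ adj x y].

Definition alpha (G : sgraph) : nat :=
  \max_(S : {set G} | independent S) #|S|.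

Definition well_covered (G : sgraph) : Prop :=
  forall S1 S2 : {set G},
    maxset (@independent G) S1 -> maxset (@independent G) S2 -> #|S1| = #|S2|.

Definition remove_vertex (G : sgraph) (v : G) : sgraph := induced [set~ v].

Definition in_W2 (G : sgraph) : Prop :=
  well_covered G /\
  forall v : G,
    well_covered (remove_vertex v) /\ alpha (remove_vertex v) = alpha G.

Definition closed_nbhd (G : sgraph) (S : {set G}) : {set G} :=
  S :|: [set y | [exists x in S, adj x y]].

Definition localization (G : sgraph) (S : {set G}) : sgraph :=
  induced (~: closed_nbhd S).

Definition triangle_free (G : sgraph) : Prop :=
  forall x y z : G, ~ [/\ adj x y, adj y z & adj z x].

Definition locally_triangle_free (G : sgraph) : Prop :=
  forall v : G, triangle_free (localization [set v]).

Section EdgeList.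
Variables (n : nat) (s : seq (nat * nat)).

(* Each edge is listed in s in one orientation only; loops in s are ignored. *)
Definition edges_adj : rel 'I_n := fun i j =>
  (i != j) && (((i : nat, j : nat) \in s) || ((j : nat, i : nat) \in s)).

Lemma edges_adj_sym : symmetric edges_adj.
Proof. by move=> i j; rewrite /edges_adj eq_sym orbC. Qed.

Lemma edges_adj_irr : irreflexive edges_adj.
Proof. by move=> i; rewrite /edges_adj eqxx. Qed.

Definition graph_of_edges : sgraph := SGraph edges_adj_sym edges_adj_irr.
End EdgeList.

Definition Q9 : sgraph := graph_of_edges 9
  (let a := 0 in let b := 1 in let c := 2 in
   let a1 := 3 in let a2 := 4 in
   let b1 := 5 in let b2 := 6 in
   let c1 := 7 in let c2 := 8 in
   [:: (a, b); (b, c); (c, a);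
       (a, a1); (a, a2); (b, b1); (b, b2); (c, c1); (c, c2);
       (a1, c1); (c1, b1); (b1, a2); (a2, c2); (c2, b2); (b2, a1)]).

Definition Q12 : sgraph := graph_of_edges 12
  (let a := 0 in let b := 1 in let c := 2 in
   let a1 := 3 in let a2 := 4 in let a3 := 5 in
   let b1 := 6 in let b2 := 7 in let b3 := 8 in
   let c1 := 9 in let c2 := 10 in let c3 := 11 in
   [:: (a, b); (b, c); (c, a);
       (a, a1); (a, a2); (a, a3);
       (b, b1); (b, b2); (b, b3);
       (c, c1); (c, c2); (c, c3);
       (a1, c1); (c1, b1); (b1, a3); (a3, c3); (c3, b3);
       (b3, a2); (a2, c2); (c2, b2); (b2, a1)]).

Definition P10 : sgraph := graph_of_edges 10
  (let a := 0 in let b := 1 in let c := 2 in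
   let x := 3 in let y := 4 in
   let a1 := 5 in let b1 := 6 in let b2 := 7 in
   let c1 := 8 in let c2 := 9 in
   [:: (a, b); (a, c); (a, a1); (a, x); (a, y);
       (b, c); (b, b1); (b, b2); (c, c1); (c, c2);
       (x, y); (x, b2); (x, c1); (y, b1); (y, c2);
       (a1, b1); (a1, b2); (a1, c1); (a1, c2); (b1, c1); (b2, c2)]).

Definition P12 : sgraph := graph_of_edges 12
  (let a := 0 in let b := 1 in let c := 2 in let d := 3 in
   let x := 4 in let y := 5 in let z := 6 in let t := 7 in
   let a1 := 8 in let b1 := 9 in let c1 := 10 in let c2 := 11 in
   [:: (a, b); (a, a1); (a, c); (a, d); (a, x); (a, y);
       (b, b1); (b, c); (b, d); (b, t); (b, z);
       (c, x); (c, z); (c, c1); (c, c2);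
       (d, y); (d, t); (d, c1); (d, c2);
       (a1, b1); (a1, z); (a1, t); (a1, c1); (a1, c2);
       (b1, x); (b1, y); (b1, c1); (b1, c2);
       (x, y); (x, t); (x, c1); (y, z); (y, c2);
       (z, t); (z, c1); (t, c2)]).

(* Main.v *)
Require Import Defs.
From mathcomp Require Import all_boot.

(* Work in the complement H of G. That G is locally triangle-free means that H
   is claw-free, that G is not a join means that H is connected, and W_2 makes
   the independence complex a pseudomanifold: every facet has exactly one flip
   at each of its vertices. For a triangle abc of G call A, B, C the sets of
   vertices H-adjacent to both b and c, to both a and c, to both a and b. By
   connectedness some triangle has two non-empty classes, and then there are
   pairwise H-adjacent p in A, q in B, s in C.
   For alpha >= 4 the link of each of a, b, c is a cross-polytope in which two
   of the classes are opposite facets, so that G consists of a, b, c and three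
   perfect matchings between A, B, C. Going round the matchings permutes A
   without fixed points; |A| >= 4 yields an independent set of size alpha + 1,
   and |A| = 3 yields Q12. For alpha = 3 all vertex links in H are 4-cycles or
   5-cycles, and the positions of the possible fifth vertices of the links of
   a, b, c give Q9, P10 or P12. *)

Set Implicit Arguments.
Unset Strict Implicit.
Unset Printing Implicit Defensive.

(** Say that a vertex misses a set if it is outside it and adjacent to none of it. No vertex x
    misses a triangle, which would lie in G_x. Hence A, B, C are disjoint and every vertex of A is
    adjacent to a. Likewise, inside G_u the neighbours of any vertex form an independent set. The
    vertices to be kept out of a facet are always of this kind, and a flip at a vertex of an
    independent set X leads out of X, so facets avoiding X exist; this is how facets of a prescribed
    shape are found. The links of a, b, c in H do not yet determine G, since a vertex adjacent to
    all three lies in none of them; connectivity is needed once more to exclude such vertices. The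
    case alpha = 3 is separate because the cross-polytope argument compares two flips of one facet
    by means of further vertices of that facet, and a facet u, c, r has too few of them: besides the
    4-cycle the 5-cycle survives as a link. The converse for the four exceptional graphs is a
    computation on their edge lists. *)

(** * Maximum independent sets and the deletion of a vertex *)

Section Independent.
Variable G : sgraph.
Implicit Types (S F X : {set G}) (x y z v : G).

Lemma independentP S :
  reflect {in S &, forall x y, ~~ adj x y} (independent S).
Proof.
apply: (iffP forall_inP) => [h x y xS yS | h x xS].
  by have /forall_inP := h x xS; apply.
by apply/forall_inP => y yS; apply: h.
Qed.

Lemma independent0 : independent (set0 : {set G}).
Proof. by apply/independentP => x y; rewrite inE. Qed.

Lemma sub_independent S F : S \subset F -> independent F -> independent S.
Proof.
move=> /subsetP sSF /independentP iF; apply/independentP => x y /sSF xF /sSF.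
exact: iF.
Qed.

Lemma independentU1 x S : independent S -> {in S, forall y, ~~ adj x y} ->
  independent (x |: S).
Proof.
move=> /independentP iS h; apply/independentP => y z /setU1P[->|yS] /setU1P[->|zS].
- by rewrite adj_irr.
- exact: h.
- by rewrite adj_sym; apply: h.
- exact: iS.
Qed.

Lemma independent_le_alpha S : independent S -> #|S| <= alpha G.
Proof. by move=> iS; exact: (@leq_bigmax_cond _ _ (fun S : {set G} => #|S|)). Qed.

Lemma alphaP : exists2 F : {set G}, independent F & #|F| = alpha G.
Proof.
case: (eq_bigmax_cond (fun S : {set G} => #|S|) (A := @independent G)).
  by apply/card_gt0P; exists set0; exact: independent0.
by move=> F iF e; exists F.
Qed.

Lemma maxset_of_alpha F : independent F -> #|F| = alpha G ->
  maxset (@independent G) F.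
Proof.
move=> iF cF; apply/maxsetP; split=> // B iB sFB; apply/eqP.
by rewrite eq_sym eqEcard sFB cF independent_le_alpha.
Qed.

Lemma well_covered_ext S : well_covered G -> independent S ->
  exists F, [/\ S \subset F, independent F & #|F| = alpha G].
Proof.
move=> wc iS; have [F mF sSF] := maxset_exists iS.
have [M iM cM] := alphaP; exists F; split=> //; first exact: maxsetp mF.
by rewrite -cM; apply: wc => //; apply: maxset_of_alpha.
Qed.

End Independent.

Section RemoveVertex.
Variables (G : sgraph) (v : G).
Let Gv := remove_vertex v.

Lemma independent_lift (S : {set Gv}) :
  independent ((val : Gv -> G) @: S) = independent S.
Proof.
apply/independentP/independentP => h x y.
  by move=> xS yS; apply: (h (val x) (val y)); apply: imset_f.
by case/imsetP=> x' xS -> /imsetP[y' yS ->]; apply: (h x' y').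
Qed.

Lemma lift_preim (S : {set G}) : v \notin S ->
  (val : Gv -> G) @: ((val : Gv -> G) @^-1: S) = S.
Proof.
move=> vS; apply/setP=> x; apply/imsetP/idP => [[y]|xS].
  by rewrite inE => yS ->.
have xv : x \in [set~ v] by rewrite !inE; apply: contraNneq vS => <-.
by exists (Sub x xv : Gv); rewrite ?inE.
Qed.

Lemma lift_notin (S : {set Gv}) : v \notin (val : Gv -> G) @: S.
Proof.
by apply/imsetP=> -[y _ e]; have := valP y; rewrite !inE -e eqxx.
Qed.

Lemma card_lift (S : {set Gv}) : #|(val : Gv -> G) @: S| = #|S|.
Proof. exact: card_imset val_inj. Qed.

End RemoveVertex.

(** Deleting [v] keeps the independence number, so a maximum extension found in the smaller graph is
    maximum in [G] as well. *)
Lemma W2_ext_avoiding (G : sgraph) (v : G) (S : {set G}) : in_W2 G ->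
  independent S -> v \notin S ->
  exists F : {set G}, [/\ S \subset F, independent F, #|F| = alpha G & v \notin F].
Proof.
move=> [_ /(_ v)[wc ea]] iS vS.
pose S' := (val : remove_vertex v -> G) @^-1: S.
have iS' : independent S' by rewrite -independent_lift lift_preim.
have [F [sF iF cF]] := well_covered_ext wc iS'.
exists (val @: F); rewrite independent_lift card_lift lift_notin cF.
by split=> //; rewrite -(lift_preim vS); apply: imsetS.
Qed.

(** * A criterion for W_2 and its computation on the exceptional graphs *)

Section TwoExtensions.
Variables (G : sgraph) (n : nat).

Definition two_extensions :=
  (forall S : {set G}, independent S -> #|S| <= n) /\
  (forall S : {set G}, independent S -> #|S| < n -> exists x y,
     [/\ x != y, x \notin S, y \notin S, independent (x |: S) &
         independent (y |: S)]).

(** Of two one-point extensions at least one avoids a prescribed [v], so every independent set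
    without [v] grows to size [n] without [v]. The criterion only speaks of adding one vertex at a
    time and can therefore be tested by enumeration. *)
Lemma two_extensions_W2 : two_extensions -> in_W2 G.
Proof.
move=> [le_n ext].
have ext_n v (S : {set G}) : independent S -> v \notin S ->
    exists F : {set G}, [/\ S \subset F, independent F, #|F| = n & v \notin F].
  have [k] := ubnP (n - #|S|); elim: k S => // k IH S lt_k iS vS.
  have := le_n S iS; rewrite leq_eqVlt => /orP[/eqP eS | ltS].
    by exists S; split.
  have [x xv [xS ix]] : exists2 x, x != v & x \notin S /\ independent (x |: S).
    have [x [y [xy xS yS ix iy]]] := ext S iS ltS.
    have [e|ne] := eqVneq x v; last by exists x.
    by exists y; rewrite -?e // eq_sym.
  have cx : #|x |: S| = #|S|.+1 by rewrite cardsU1 xS.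
  have [||| F [sF iF cF vF]] := IH (x |: S) => //.
  - rewrite cx; move: lt_k; rewrite subnS ltnS.
    by case: (n - #|S|) (subn_gt0 #|S| n) => [|m _]; rewrite ?ltS.
  - by rewrite !inE negb_or eq_sym xv.
  - by exists F; split=> //; apply: subset_trans sF; apply: subsetUr.
have max_n (S : {set G}) : maxset (@independent G) S -> #|S| = n.
  move=> mS; have iS := maxsetp mS; apply/eqP; rewrite eqn_leq le_n //= leqNgt.
  apply/negP=> ltS; have [x [y [_ xS _ ix _]]] := ext S iS ltS.
  have e := maxsetsup mS ix (subsetUr _ _).
  by rewrite -e setU11 in xS.
have an : alpha G = n.
  by have [F iF cF] := alphaP G; rewrite -cF max_n //; apply: maxset_of_alpha.
split=> [S1 S2 m1 m2 | v]; first by rewrite !max_n.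
have max_v (S : {set remove_vertex v}) :
    maxset (@independent (remove_vertex v)) S -> #|S| = n.
  move=> mS; have iS := maxsetp mS; rewrite -card_lift.
  have [|F [sF iF cF vF]] := ext_n v _ _ (lift_notin S).
    by rewrite independent_lift.
  suff e : (val : remove_vertex v -> G) @^-1: F = S by rewrite -e lift_preim.
  apply: (maxsetsup mS); first by rewrite -independent_lift lift_preim.
  by apply/subsetP=> x xS; rewrite inE (subsetP sF) // imset_f.
split=> [S1 S2 m1 m2 | ]; first by rewrite !max_v.
have [F iF cF] := alphaP (remove_vertex v).
by rewrite an -cF max_v //; apply: maxset_of_alpha.
Qed.

End TwoExtensions.

(* Runs through all sequences of pairwise non-adjacent elements; s holds the
   elements that can still be added. *)
Fixpoint ext_check (T : eqType) (e : rel T) n (s : seq T) : bool :=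
  if n is m.+1 then
    (1 < size s) &&
    all (fun v => ext_check e m [seq w <- s | (w != v) && ~~ e v w]) s
  else nilp s.

Lemma ext_check_map (T U : eqType) (f : T -> U) (e : rel T) (e' : rel U) n s :
  injective f -> (forall x y, e' (f x) (f y) = e x y) ->
  ext_check e' n (map f s) = ext_check e n s.
Proof.
move=> injf ef; elim: n s => [|n IH] s /=; first by case: s.
rewrite size_map all_map; congr andb; apply: eq_all => v /=.
rewrite filter_map IH; congr (ext_check _ _ _); apply: eq_filter => w /=.
by rewrite ef (inj_eq injf).
Qed.

(** The elements of [S] may be removed in any order: for [v] in [S] the filtered list still contains
    [S :\ v], and what is found there misses [v] because of the filter. For empty [S] the test on
    the size of [s] gives the two extensions. *)
Lemma ext_checkP (G : sgraph) n (s : seq G) : uniq s ->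
  ext_check (@adj G) n s -> forall S : {set G}, independent S ->
  {subset S <= s} -> #|S| <= n /\ (#|S| < n -> exists x y,
     [/\ x != y, x \in s, y \in s, {in S, forall w, (x != w) && ~~ adj w x} &
         {in S, forall w, (y != w) && ~~ adj w y}]).
Proof.
elim: n s => [|n IH] s us /=.
  move=> /nilP-> S _ sS; split=> //; rewrite leqn0 cards_eq0 -subset0.
  by apply/subsetP=> x /sS.
case/andP=> s_gt1 /allP chk S iS sS.
have [->|[v vS]] := set_0Vmem S.
  rewrite cards0; split=> // _.
  case: s us s_gt1 {chk sS} => [|x [|y s]] //= /andP[xs _] _.
  exists x, y; rewrite !inE !eqxx orbT; split=> //; try by move=> w; rewrite inE.
  by apply: contraNneq xs => ->; rewrite inE eqxx.
have cS : #|S| = #|S :\ v|.+1 by rewrite (cardsD1 v) vS.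
have iSv := sub_independent (subsetDl S [set v]) iS.
have [|le_n ext] := IH _ (filter_uniq _ us) (chk v (sS v vS)) _ iSv.
  move=> w /setD1P[wv wS]; rewrite mem_filter wv sS // andbT.
  by have /independentP := iS; apply.
rewrite cS !ltnS; split=> // /ext[x [y [xy]]].
rewrite !mem_filter => /andP[/andP[xv vx] xs] /andP[/andP[yv vy] ys] hx hy.
exists x, y; split=> // w wS; have [-> //|wv] := eqVneq w v.
- by rewrite xv.
- by apply: hx; rewrite !inE wv.
- by rewrite yv.
- by apply: hy; rewrite !inE wv.
Qed.

Definition nat_adj (s : seq (nat * nat)) : rel nat := fun i j =>
  (i != j) && (((i, j) \in s) || ((j, i) \in s)).

Definition ltf_check n (s : seq (nat * nat)) : bool :=
  let V := iota 0 n in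
  all (fun v => let L := [seq w <- V | (w != v) && ~~ nat_adj s v w] in
    all (fun x => all (fun y => nat_adj s x y ==>
      all (fun z => ~~ (nat_adj s y z && nat_adj s z x)) L) L) L) V.

Lemma locally_triangle_freeP (G : sgraph) :
  locally_triangle_free G <->
  (forall v x y z : G, v != x -> ~~ adj v x -> v != y -> ~~ adj v y ->
     v != z -> ~~ adj v z -> ~ [/\ adj x y, adj y z & adj z x]).
Proof.
have outE (v x : G) : (x \in ~: closed_nbhd [set v]) = (v != x) && ~~ adj v x.
  rewrite !inE negb_or eq_sym; congr (_ && ~~ _).
  apply/existsP/idP => [[w /andP[/set1P-> //]]|vx].
  by exists v; rewrite set11.
split=> [h v x y z vx ax vy ay vz az|h v [x hx] [y hy] [z hz]].
  have hx : x \in ~: closed_nbhd [set v] by rewrite outE vx.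
  have hy : y \in ~: closed_nbhd [set v] by rewrite outE vy.
  have hz : z \in ~: closed_nbhd [set v] by rewrite outE vz.
  exact: (h v (Sub x hx) (Sub y hy) (Sub z hz)).
have := hx; have := hy; have := hz; rewrite !outE.
by move=> /andP[h1 h2] /andP[h3 h4] /andP[h5 h6]; apply: (h v x y z).
Qed.

(** Both tests run on natural numbers, so that evaluation never meets ordinals or finite types; [F]
    and [t] carry the results back to [G]. *)
Lemma check_edge_list (G : sgraph) n s k :
  isomorphic G (graph_of_edges n s) ->
  ext_check (nat_adj s) k (iota 0 n) -> ltf_check n s ->
  locally_triangle_free G /\ in_W2 G.
Proof.
move=> [f [[g gK fK] fadj]] chk ltf.
pose F x : nat := val (f x).
have injF : injective F by move=> x y /val_inj/(can_inj gK).
have Fadj x y : nat_adj s (F x) (F y) = adj x y by rewrite -fadj.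
pose t := map g (enum 'I_n).
have Ft : map F t = iota 0 n.
  rewrite -map_comp -val_enum_ord; apply: eq_map => i /=.
  by rewrite /F fK.
have tP x : x \in t by rewrite -[x]gK map_f ?mem_enum.
have ut : uniq t by rewrite map_inj_uniq ?enum_uniq //; apply: can_inj fK.
split; last first.
  apply: (@two_extensions_W2 _ k).
  rewrite -Ft (ext_check_map _ _ injF Fadj) in chk.
  split=> S iS; first by case: (ext_checkP ut chk iS) => // x _.
  case: (ext_checkP ut chk iS) => [x _ //|_ ext /ext[x [y [xy _ _ hx hy]]]].
  exists x, y; split=> //.
  - by apply/negP=> /hx; rewrite eqxx.
  - by apply/negP=> /hy; rewrite eqxx.
  - by apply: independentU1 => // w /hx /andP[_]; rewrite adj_sym.
  - by apply: independentU1 => // w /hy /andP[_]; rewrite adj_sym.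
apply/locally_triangle_freeP => v x y z vx ax vy ay vz az [xy yz zx].
have mF w : F w \in iota 0 n by rewrite -Ft map_f.
have mL w : v != w -> ~~ adj v w ->
    F w \in [seq w <- iota 0 n | (w != F v) && ~~ nat_adj s (F v) w].
  by move=> vw aw; rewrite mem_filter mF Fadj aw (inj_eq injF) eq_sym vw.
move: ltf => /allP/(_ _ (mF v))/allP/(_ _ (mL x vx ax))/allP/(_ _ (mL y vy ay)).
by rewrite Fadj xy /= => /allP/(_ _ (mL z vz az)); rewrite !Fadj yz zx.
Qed.

Lemma exceptional_graphs (G : sgraph) :
  isomorphic G Q9 \/ isomorphic G Q12 \/ isomorphic G P10 \/ isomorphic G P12 ->
  locally_triangle_free G /\ in_W2 G.
Proof.
move=> [|[|[]]] iso.
(* [k] is the independence number, which is 4 for [Q12] and 3 for the others. *)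
- by apply: (check_edge_list (k := 3) iso); vm_compute.
- by apply: (check_edge_list (k := 4) iso); vm_compute.
- by apply: (check_edge_list (k := 3) iso); vm_compute.
- by apply: (check_edge_list (k := 3) iso); vm_compute.
Qed.

(** * The complement [co], its facets and their flips *)

Section LocallyTriangleFreeW2.
Variable G : sgraph.
Hypotheses (ltf : locally_triangle_free G) (w2 : in_W2 G).
Implicit Types (S F X T : {set G}) (x y z u v w t a b c r : G).

Definition co x y := (x != y) && ~~ adj x y.

Lemma co_sym x y : co x y = co y x.
Proof. by rewrite /co eq_sym adj_sym. Qed.

Lemma coxx x : co x x = false.
Proof. by rewrite /co eqxx. Qed.

Lemma co_neq x y : co x y -> x != y.
Proof. by case/andP. Qed.

Lemma co_adjF x y : co x y -> adj x y = false.
Proof. by case/andP=> _ /negbTE. Qed.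

Lemma adj_coF x y : adj x y -> co x y = false.
Proof. by rewrite /co => ->; rewrite andbF. Qed.

Lemma adj_neq x y : adj x y -> x != y.
Proof. by apply: contraTneq => ->; rewrite adj_irr. Qed.

Lemma coP x y : x != y -> ~~ adj x y -> co x y.
Proof. by rewrite /co => -> ->. Qed.

Lemma adjP x y : x != y -> ~~ co x y -> adj x y.
Proof. by rewrite /co => -> /negbNE. Qed.

Lemma link_tri u x y z : co u x -> co u y -> co u z ->
  adj x y -> adj y z -> adj x z = false.
Proof.
move=> /andP[? ?] /andP[? ?] /andP[? ?] xy yz; apply/negP; rewrite adj_sym => zx.
by have /locally_triangle_freeP /(_ u x y z) := ltf; apply.
Qed.

Lemma link_co u x y z : co u x -> co u y -> co u z -> x != z ->
  adj x y -> adj y z -> co x z.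
Proof. by move=> ux uy uz xz xy yz; rewrite coP // (link_tri ux uy uz). Qed.

Lemma independent_co S : independent S -> {in S &, forall x y, x != y -> co x y}.
Proof. by move=> /independentP h x y xS yS ?; rewrite coP // h. Qed.

Lemma independentU1_co x S : independent S -> {in S, forall y, co x y} ->
  independent (x |: S).
Proof. by move=> iS h; apply: independentU1 => // y /h/co_adjF->. Qed.

Lemma in_co_notin x S : {in S, forall y, co x y} -> x \notin S.
Proof. by move=> h; apply/negP=> /h; rewrite coxx. Qed.

Definition facet F := independent F && (#|F| == alpha G).

Lemma facet_ind F : facet F -> independent F.
Proof. by case/andP. Qed.

Lemma facet_card F : facet F -> #|F| = alpha G.
Proof. by case/andP=> _ /eqP. Qed.

Lemma facet_co F : facet F -> {in F &, forall x y, x != y -> co x y}.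
Proof. by move=> /facet_ind; apply: independent_co. Qed.

Lemma facet_max F x : facet F -> {in F, forall y, co x y} -> False.
Proof.
move=> fF h; have := independent_le_alpha (independentU1_co (facet_ind fF) h).
by rewrite cardsU1 in_co_notin // -(facet_card fF) add1n ltnn.
Qed.

(** W_2 extends [F :\ v] to a maximum set avoiding [v], which has exactly one new point [y]; if [y]
    were not adjacent to [v], it would extend [F]. *)
Lemma flip F v : facet F -> v \in F -> exists y,
  [/\ adj v y, {in F :\ v, forall z, co y z} & facet (y |: (F :\ v))].
Proof.
move=> fF vF; have iFv := sub_independent (subsetDl F [set v]) (facet_ind fF).
have [|F' [sF iF' cF' vF']] := W2_ext_avoiding w2 iFv (v := v).
  by rewrite !inE eqxx.
have /eqP : #|F' :\: (F :\ v)| = 1.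
  rewrite cardsD (setIidPr sF) cF' -(facet_card fF) (cardsD1 v F) vF add1n.
  by rewrite subSnn.
move=> /cards1P[y ey].
have /setDP[yF' yF] : y \in F' :\: (F :\ v) by rewrite ey set11.
have yco : {in F :\ v, forall z, co y z}.
  move=> z zF; apply: (independent_co iF') => //; first exact: (subsetP sF).
  by apply: contraNneq yF => ->.
have yv : y != v by apply: contraNneq vF' => <-.
exists y; split=> //; last first.
  rewrite /facet independentU1_co //= cardsU1 yF -(facet_card fF).
  by rewrite (cardsD1 v F) vF.
rewrite adj_sym; apply: adjP => //; apply/negP=> yvco.
apply: (facet_max fF (x := y)) => z zF.
by have [-> //|zv] := eqVneq z v; apply: yco; rewrite !inE zv.
Qed.

(** By maximality of [F] both [x] and [y] are adjacent to [v]. The bound on alpha supplies another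
    point [w] of [F], and all three lie in G_w; so distinct [x] and [y] would be non-adjacent and
    could both be added to [F :\ v]. *)
Lemma ridge_uniq F v x y : 1 < alpha G -> facet F -> v \in F ->
  x != v -> y != v -> {in F :\ v, forall z, co x z} ->
  {in F :\ v, forall z, co y z} -> x = y.
Proof.
move=> a1 fF vF xv yv hx hy; apply/eqP; apply: contraT => xy.
have adjv z : z != v -> {in F :\ v, forall t, co z t} -> adj v z.
  move=> zv hz; rewrite adj_sym adjP //; apply/negP=> zvco.
  apply: (facet_max fF (x := z)) => t tF.
  by have [-> //|tv] := eqVneq t v; apply: hz; rewrite !inE tv.
have axv := adjv x xv hx; have ayv := adjv y yv hy.
have /card_gt0P[w wF] : 0 < #|F :\ v|.
  by move: a1; rewrite -(facet_card fF) (cardsD1 v F) vF.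
have wv : co w v.
  by case/setD1P: wF => wv wF; apply: (facet_co fF).
have xyco : co x y.
  apply: (@link_co w x v y); rewrite ?(co_sym w) ?hx ?hy // 1?co_sym //.
  by rewrite adj_sym.
have fFx : facet (x |: (F :\ v)).
  rewrite /facet independentU1_co ?(sub_independent (subsetDl F _)) ?facet_ind //=.
  by rewrite cardsU1 in_co_notin // -(facet_card fF) (cardsD1 v F) vF.
exfalso; apply: (facet_max fFx (x := y)) => z /setU1P[-> |]; last exact: hy.
by rewrite co_sym.
Qed.

Lemma facet_avoiding S X : independent S -> independent X -> [disjoint S & X] ->
  exists F : {set G}, [/\ facet F, S \subset F & [disjoint F & X]].
Proof.
(* A flip at v in F :&: X leaves X, since X is independent; so a facet that
   meets X in as few points as possible avoids it. *)
move=> iS iX dSX.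
have [F0 [sF0 iF0 cF0]] := well_covered_ext (proj1 w2) iS.
have f0 : facet F0 && (S \subset F0) by rewrite /facet iF0 cF0 eqxx.
pose P F := facet F && (S \subset F).
case: (@arg_minnP _ F0 P (fun F => #|F :&: X|) f0) => F /andP[fF sSF] minF.
exists F; split=> //; rewrite -setI_eq0 -cards_eq0; apply: contraT.
rewrite -lt0n => /card_gt0P[v /setIP[vF vX]].
have [y [vy yco fy]] := flip fF vF.
have vS : v \notin S.
  by apply: contraTN vX => vS; rewrite (disjointFr dSX vS).
have /minF : P (y |: (F :\ v)).
  rewrite /P fy; apply/subsetP=> z zS; rewrite !inE (subsetP sSF) // andbT orbC.
  by rewrite (contraNneq _ vS) // => <-.
rewrite leqNgt => /negP[]; rewrite (cardsD1 v (F :&: X)) inE vF vX /= add1n ltnS.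
rewrite subset_leq_card //.
apply/subsetP=> z; rewrite !inE => /andP[/orP[/eqP->|/andP[-> ->]] zX] //.
by have /independentP/(_ v y vX zX) := iX; rewrite vy.
Qed.

(** The neighbours of [a] that miss [b] and [T] are independent, being neighbours of [a] in G_t. In
    a facet through [b] and [T] that avoids them only [b] is adjacent to [a]; so [a] is its flip at
    [b]. *)
Lemma facet_of_edge a b T t : adj a b -> independent T -> t \in T ->
  {in T, forall x, co a x} -> {in T, forall x, co b x} ->
  exists F : {set G},
    [/\ facet F, b \in F, T \subset F & {in F :\ b, forall x, co a x}].
Proof.
move=> ab iT tT Ta Tb.
pose X := [set x | adj a x && [forall y in b |: T, co x y]].
have coX x : x \in X -> {in b |: T, forall y, co x y}.
  by rewrite inE => /andP[_ /forall_inP].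
have adjX x : x \in X -> adj a x by rewrite inE => /andP[].
have tT' : t \in b |: T by rewrite inE tT orbT.
have iX : independent X.
  apply/independentP=> x y xX yX.
  rewrite (@link_tri t x a y) //; last 1 first.
  - exact: adjX.
  - by rewrite co_sym; apply: coX.
  - by rewrite co_sym; apply: Ta.
  - by rewrite co_sym; apply: coX.
  - by rewrite adj_sym; apply: adjX.
have iS : independent (b |: T) by apply: independentU1_co.
have dX : [disjoint b |: T & X].
  apply/pred0P=> x /=; apply/negP=> /andP[xT /coX/(_ x xT)]; rewrite coxx //.
have [F [fF sF dF]] := facet_avoiding iS iX dX.
have bF : b \in F by rewrite (subsetP sF) ?setU11.
exists F; split=> //; first exact: subset_trans (subsetUr _ _) sF.
move=> x /setD1P[xb xF]; have [xT|xT] := boolP (x \in T); first exact: Ta.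
apply: coP.
  apply/eqP=> ax; have := facet_co fF xF bF xb.
  by rewrite -ax adj_coF.
apply: contraT => /negbNE ax; have : x \notin X by rewrite (disjointFr dF).
rewrite inE ax /= => /forall_inP[] y yT; apply: (facet_co fF) => //.
  exact: (subsetP sF).
by apply: contraNneq xT => e; move: yT; rewrite -e !inE (negbTE xb).
Qed.

(** * Triangles of G and their three classes *)

Definition tri a b c := [&& adj a b, adj b c & adj c a].

Lemma tri_rot a b c : tri a b c -> tri b c a.
Proof. by case/and3P=> ? ? ?; apply/and3P. Qed.

Lemma tri_swap a b c : tri a b c -> tri b a c.
Proof. by case/and3P=> ? ? ?; apply/and3P; split; rewrite adj_sym. Qed.

Lemma tri_cover a b c x : tri a b c -> co x a -> co x b -> co x c -> False.
Proof.
case/and3P=> ab bc ca xa xb xc; have := link_tri xa xb xc ab bc.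
by rewrite adj_sym ca.
Qed.

Lemma tri_adj a b c x : tri a b c -> co x a -> co x c -> adj b x.
Proof.
move=> t xa xc; rewrite adj_sym adjP //.
  apply: contraTneq xa => ->; case/and3P: t => ? _ _.
  by rewrite co_sym adj_coF.
by apply/negP=> xb; apply: (tri_cover t xa xb xc).
Qed.

(* For a triangle abc, cls b c is the class A of the header. *)
Definition cls a b := [set x | co a x && co b x].

Lemma clsC a b : cls a b = cls b a.
Proof. by apply/setP=> x; rewrite !inE andbC. Qed.

Lemma clsP a b x : reflect (co a x /\ co b x) (x \in cls a b).
Proof. by rewrite inE; apply: andP. Qed.

(** In the link of the H-edge [u c], these are the vertices not H-adjacent to [b]. If [u] misses
    [b], they are neighbours of [b] in G_u and hence independent. *)
Definition side b u c := [set x | [&& adj b x, co u x & co c x]].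

Lemma side_ind b u c : co u b -> independent (side b u c).
Proof.
move=> ub; apply/independentP=> x y; rewrite !inE.
move=> /and3P[bx ux _] /and3P[by_ uy _].
by rewrite (link_tri ux ub uy) // adj_sym.
Qed.

Lemma side_star b u c : co u b -> co u c -> independent (u |: (c |: side b u c)).
Proof.
move=> ub uc; apply: independentU1_co; first apply: independentU1_co.
- exact: side_ind.
- by move=> x; rewrite inE => /and3P[].
- by move=> x; rewrite !inE => /orP[/eqP-> //|/and3P[]].
Qed.

Lemma card_side b u c : co u c -> #|u |: (c |: side b u c)| = #|side b u c|.+2.
Proof.
by move=> uc; rewrite !cardsU1 !inE !coxx !andbF (negbTE (co_neq uc)).
Qed.

(** The neighbours of [a] that miss [r], [u] and [c] are independent, since G_r is triangle-free;
    take a facet through [r], [u], [c] avoiding them. Its points other than [u] and [c] miss [a], so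
    they are adjacent to [b] and lie in [side b u c]. As this side together with [u] and [c] is
    independent, counting gives equality. *)
Lemma side_facet a b c u r : tri a b c -> u \in cls b c -> r \in cls a c ->
  co u r -> side b u c \subset cls a c /\ facet (u |: (c |: side b u c)).
Proof.
move=> abc /clsP[bu cu] /clsP[ar cr] ur; have /and3P[ab bc ca] := abc.
pose T := r |: (u |: [set c]).
have iT : independent T.
  apply: independentU1_co; first apply: independentU1_co.
  - by apply/independentP=> x y /set1P-> /set1P->; rewrite adj_irr.
  - by move=> x /set1P->; rewrite co_sym.
  - by move=> x /setU1P[->|/set1P->]; rewrite co_sym.
pose X := [set x | adj a x && [forall y in T, co x y]].
have coX x : x \in X -> {in T, forall y, co x y}.
  by rewrite inE => /andP[_ /forall_inP].
have rT : r \in T by rewrite setU11.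
have uT : u \in T by rewrite !inE eqxx orbT.
have cT : c \in T by rewrite !inE eqxx !orbT.
have iX : independent X.
  apply/independentP=> x y xX yX.
  move: (xX) (yX); rewrite !inE => /andP[ax _] /andP[ay _].
  rewrite (@link_tri r x a y) //; first by rewrite co_sym; apply: coX.
  - by rewrite co_sym.
  - by rewrite co_sym; apply: coX.
  - by rewrite adj_sym.
have dX : [disjoint T & X].
  by apply/pred0P=> x /=; apply/negP=> /andP[xT /coX/(_ x xT)]; rewrite coxx.
have [F [fF sF dF]] := facet_avoiding iT iX dX.
have [rF uF cF] : [/\ r \in F, u \in F & c \in F].
  by split; apply: (subsetP sF).
pose J := F :\ u :\ c.
have JA : {in J, forall y, co a y}.
  move=> y /setD1P[yc /setD1P[yu yF]].
  have [-> //|yr] := eqVneq y r.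
  have ya : a != y.
    by apply: contraTneq ca => ->; rewrite (co_adjF (facet_co fF cF yF _)) // eq_sym.
  apply: coP => //; apply: contraT => /negbNE ay.
  have : y \notin X by rewrite (disjointFr dF).
  rewrite inE ay /= => /forall_inP[] z; rewrite !inE.
  by move=> /or3P[] /eqP->; apply: (facet_co fF).
have JI : J \subset side b u c.
  apply/subsetP=> y yJ; have ay := JA y yJ.
  case/setD1P: yJ => yc /setD1P[yu yF].
  have cy : co c y by apply: (facet_co fF); rewrite // eq_sym.
  have uy : co u y by apply: (facet_co fF); rewrite // eq_sym.
  by rewrite inE uy cy (tri_adj abc) // co_sym.
have ub : co u b by rewrite co_sym.
have uc : co u c by rewrite co_sym.
have iU := side_star ub uc.
have leI := independent_le_alpha iU; rewrite card_side // in leI.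
have cJ : #|J|.+2 = alpha G.
  by rewrite -(facet_card fF) (cardsD1 u F) uF (cardsD1 c (F :\ u)) !inE cF (co_neq cu).
have eJ : side b u c = J.
  by apply/eqP; rewrite eq_sym eqEcard JI -ltnS -ltnS cJ.
split; last by rewrite /facet iU card_side //= eJ cJ.
rewrite eJ; apply/subsetP=> y yJ; apply/clsP; split; first exact: JA.
by case/setD1P: yJ => yc /setD1P[yu yF]; apply: (facet_co fF); rewrite // eq_sym.
Qed.

Lemma cls_linked a b c x y : 2 < alpha G -> tri a b c ->
  x \in cls b c -> y \in cls a c ->
  exists u r, [/\ u \in cls b c, r \in cls a c & co u r].
Proof.
(* If no such pair existed, all the sets side b u c and side a r c would be equal,
   and an element of this common set would extend a facet contained in c |: cls b c. *)
move=> a2 abc xA yB.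
have [/existsP[u /existsP[r /and3P[? ? ?]]]|none] :=
  boolP [exists u, exists r, [&& u \in cls b c, r \in cls a c & co u r]].
  by exists u, r.
have nco u r : u \in cls b c -> r \in cls a c -> co u r -> False.
  move=> uA rB ur; case/negP: none.
  by apply/existsP; exists u; apply/existsP; exists r; rewrite uA rB.
have /and3P[ab bc ca] := abc; exfalso.
(* [Q] is a facet through [u] and [c], with flip [r] at [u], minus [u] and [c]. Its points miss [u],
   [r] and [c]; as no pair is linked, they are adjacent to both [a] and [b], so [Q] lies in both
   sides and equals them by counting. *)
have sideE u r : u \in cls b c -> r \in cls a c ->
    exists Q : {set G}, [/\ 0 < #|Q|, side b u c = Q & side a r c = Q].
  move=> uA rB; have [/clsP[bu cu] /clsP[ar cr]] := conj uA rB.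
  have ur : u != r.
    by apply/eqP=> e; apply: (@tri_cover a b c u); rewrite // 1?co_sym ?e // -e.
  have aur : adj u r by apply: adjP => //; apply/negP=> /(nco u r uA rB).
  have [] := @facet_of_edge r u [set c] c _ _ (set11 c).
  - by rewrite adj_sym.
  - by apply/independentP=> ? ? /set1P-> /set1P->; rewrite adj_irr.
  - by move=> ? /set1P->; rewrite co_sym.
  - by move=> ? /set1P->; rewrite co_sym.
  move=> F [fF uF]; rewrite sub1set => cF Fr.
  pose Q := F :\ u :\ c.
  have cQ : #|Q|.+2 = alpha G.
    rewrite -(facet_card fF) (cardsD1 u F) uF (cardsD1 c (F :\ u)) !inE cF.
    by rewrite (co_neq cu).
  have QP q : q \in Q -> [/\ co c q, co u q & co r q].
    case/setD1P=> qc /setD1P[qu qF]; split; last by apply: Fr; rewrite !inE qu.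
      by apply: (facet_co fF); rewrite // eq_sym.
    by apply: (facet_co fF); rewrite // eq_sym.
  have Qa q : q \in Q -> adj a q.
    move=> /QP[cq uq rq]; apply: adjP.
      by apply: contraTneq cq => <-; rewrite adj_coF.
    apply/negP=> aq; apply: (nco u q) => //; exact/clsP.
  have Qb q : q \in Q -> adj b q.
    move=> /QP[cq uq rq]; apply: adjP.
      by apply: contraTneq cq => <-; rewrite co_sym adj_coF.
    apply/negP=> bq; apply: (nco q r) => //; first exact/clsP.
    by rewrite co_sym.
  have eq_side e v : co v e -> co v c -> {in Q, forall q, adj e q} ->
      {in Q, forall q, co v q} -> side e v c = Q.
    move=> ve vc eQ vQ; apply/eqP; rewrite eq_sym eqEcard; apply/andP; split.
      by apply/subsetP=> q qQ; rewrite inE eQ // vQ //; case: (QP q qQ) => ->.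
    rewrite -ltnS -ltnS cQ -(card_side _ vc); apply: independent_le_alpha.
    exact: side_star.
  exists Q; split.
  - by move: a2; rewrite -cQ !ltnS.
  - by apply: eq_side; rewrite 1?co_sym // => q /QP[].
  - by apply: eq_side; rewrite 1?co_sym // => q /QP[].
have [Q [/card_gt0P[q qQ] _ eyQ]] := sideE x y xA yB.
have qside s : s \in cls b c -> q \in side b s c.
  move=> sA; have [Q' [_ e1 e2]] := sideE s y sA yB.
  by rewrite e1 -e2 eyQ.
have [bx cx] := clsP _ _ _ xA.
have [] := @facet_of_edge b c [set x] x bc _ (set11 x).
- by apply/independentP=> ? ? /set1P-> /set1P->; rewrite adj_irr.
- by move=> ? /set1P->.
- by move=> ? /set1P->.
move=> S [fS cS _ Sb]; apply: (facet_max fS (x := q)) => s sS.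
have := qside x xA; rewrite inE => /and3P[_ _ cq].
have [->|sc] := eqVneq s c; first by rewrite co_sym.
have sA : s \in cls b c.
  apply/clsP; split; first by apply: Sb; rewrite !inE sc.
  by apply: (facet_co fS); rewrite // eq_sym.
by have := qside s sA; rewrite inE co_sym => /and3P[].
Qed.

(** [z] is the flip at [c] of the facet from [side_facet]. In G_r the path [a], [c], [z] shows that
    [z] misses [a], and in G_u the path [b], [c], [z] shows that it misses [b]. *)
Lemma third_cls a b c u r : tri a b c -> u \in cls b c -> r \in cls a c ->
  co u r -> exists z, [/\ z \in cls a b, co u z & co r z].
Proof.
move=> abc uA rB ur; have [_ fI] := side_facet abc uA rB ur.
have [[bu cu] [ar cr]] := (clsP _ _ _ uA, clsP _ _ _ rB).
have /and3P[ab bc ca] := abc.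
have rI : r \in side b u c.
  by rewrite inE ur cr (tri_adj abc) // co_sym.
have [|z [cz zco _]] := flip fI (v := c); first by rewrite !inE eqxx orbT.
have zu : co z u by apply: zco; rewrite !inE eqxx (co_neq _) // co_sym.
have zr : co z r.
  by apply: zco; rewrite in_setD1 eq_sym (co_neq cr) !in_setU1 rI !orbT.
have az : a != z.
  apply: contraTneq zu => <-; apply/negP=> au.
  by apply: (@tri_cover a b c u); rewrite // co_sym.
have bz : b != z.
  apply: contraTneq zr => <-; apply/negP=> br.
  by apply: (@tri_cover a b c r); rewrite // co_sym.
exists z; split; try by rewrite co_sym.
apply/clsP; split.
  by apply: (@link_co r a c z) => //; rewrite 1?co_sym // 1?adj_sym.
by apply: (@link_co u b c z) => //; rewrite 1?co_sym // 1?adj_sym.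
Qed.

(** * Connectivity of the complement and the choice of the triangle *)

Lemma cut_edge (D : {set G}) x y : ~ is_proper_join G -> x \in D -> y \notin D ->
  exists u v, [/\ u \in D, v \notin D & co u v].
Proof.
move=> nj xD yD.
have [/existsP[u /existsP[v /and3P[? ? ?]]]|none] :=
  boolP [exists u, exists v, [&& u \in D, v \notin D & co u v]].
  by exists u, v.
case: nj; have full u v : u \in D -> v \notin D -> adj u v.
  move=> uD vD; apply: adjP; first by apply: contraNneq vD => <-.
  apply: contraNN none => uv; apply/existsP; exists u; apply/existsP; exists v.
  by rewrite uD vD.
pose G1 := induced D; pose G2 := induced (~: D).
pose g (z : G1 + G2) : G := match z with inl w => val w | inr w => val w end.
have injg : injective g.
  move=> [[u uD]|[u uD]] [[v vD]|[v vD]] //= e.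
  - by congr inl; apply: val_inj.
  - by exfalso; move: (vD); rewrite inE -e uD.
  - by exfalso; move: (uD); rewrite inE e vD.
  - by congr inr; apply: val_inj.
have [|f fK gK] := inj_card_bij injg.
  by rewrite card_sum !card_sig -(cardsC D).
exists G1, G2; split.
- by apply/card_gt0P; exists (Sub x xD).
- have yD' : y \in ~: D by rewrite inE.
  by apply/card_gt0P; exists (Sub y yD').
exists f; split; first by exists g.
have gadj (z w : G1 + G2) : adj (g z) (g w) = join_adj z w.
  case: z w => [[u uD]|[u uD]] [[v vD]|[v vD]] //=.
  - by rewrite full //; move: (vD); rewrite inE.
  - by rewrite adj_sym full //; move: (uD); rewrite inE.
by move=> u v; rewrite -{2}(gK u) -{2}(gK v) gadj.
Qed.

(** Connectivity of H is used twice: for a triangle with one non-empty class, then for one with two.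
    The third class is filled by [cls_linked] and [third_cls]. *)
Lemma good_triangle a b c : 2 < alpha G -> ~ is_proper_join G -> tri a b c ->
  exists a b c, [/\ tri a b c, exists x, x \in cls b c, exists x, x \in cls a c &
                    exists x, x \in cls a b].
Proof.
move=> a2 nj.
have final a' b' c' x y : tri a' b' c' -> x \in cls b' c' -> y \in cls a' c' ->
    exists a b c, [/\ tri a b c, exists x, x \in cls b c,
                      exists x, x \in cls a c & exists x, x \in cls a b].
  move=> t xA yB; have [u [r [uA rB ur]]] := cls_linked a2 t xA yB.
  have [z [zC _ _]] := third_cls t uA rB ur.
  exists a', b', c'; split=> //; by [exists x | exists y | exists z].
have step2 a' b' c' v : tri a' b' c' -> v \in cls a' b' ->
    exists a b c, [/\ tri a b c, exists x, x \in cls b c,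
                      exists x, x \in cls a c & exists x, x \in cls a b].
  move=> /and3P[ab bc ca] vC.
  (* An H-edge [y z] leaving [D] has [z] adjacent to [a'] and [b'], so [z] can replace [c']. Then
     [y] misses [z] and one of [a'], [b'], while [v] misses both of these: two classes are
     non-empty. *)
  pose D := [set x | [|| x == a', x == b', co a' x | co b' x]].
  have [||y [z [yD]]] := @cut_edge D a' c' nj; rewrite ?inE ?eqxx //.
    rewrite !negb_or (eq_sym c' a') (eq_sym c' b') (adj_neq bc).
    by rewrite (eq_sym a') (adj_neq ca) (adj_coF bc) co_sym (adj_coF ca).
  rewrite !negb_or => /and4P[za zb az bz] yz.
  have azz : adj a' z by apply: adjP; rewrite // eq_sym.
  have bzz : adj b' z by apply: adjP; rewrite // eq_sym.
  have zy : co z y by rewrite co_sym.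
  have tz : tri b' z a' by rewrite /tri bzz ab adj_sym azz.
  have : co a' y || co b' y.
    move: yD; rewrite inE => /or4P[/eqP e|/eqP e|->|->]; rewrite ?orbT //.
      by rewrite e adj_coF in yz.
    by rewrite e adj_coF in yz.
  case/orP=> [ay|by_].
    by apply: (@final b' z a' y v tz); [apply/clsP | rewrite clsC].
  have tz' : tri a' z b' by rewrite /tri azz adj_sym bzz adj_sym ab.
  by apply: (@final a' z b' y v tz'); first exact/clsP.
move=> abc; have /and3P[ab bc ca] := abc.
(* Here [a] and [z] are adjacent and [y] misses both, so any triangle through [a] and [z] will do.
   If [z] is not in the triangle and is adjacent to neither [b] nor [c], then [z] itself lies in
   [cls b c]. *)
have [||y [z [yD zD yz]]] := @cut_edge [set x | (x == a) || co a x] a b nj.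
- by rewrite inE eqxx.
- by rewrite inE eq_sym (negbTE (adj_neq ab)) adj_coF.
move: zD; rewrite inE negb_or => /andP[za az].
have {az} aaz : adj a z by apply: adjP; rewrite // eq_sym.
have ay : co a y.
  move: yD; rewrite inE => /orP[/eqP e|//]; by rewrite e adj_coF in yz.
have zy : co z y by rewrite co_sym.
have hit b' c' : tri a b' c' -> adj z b' ->
    exists a b c, [/\ tri a b c, exists x, x \in cls b c,
                      exists x, x \in cls a c & exists x, x \in cls a b].
  move=> /and3P[ab' _ _] zb'; apply: (@step2 a z b' y); last exact/clsP.
  by rewrite /tri aaz zb' adj_sym.
have [ezb|zb] := eqVneq z b.
  by apply: (@step2 a b c y); rewrite // -ezb; apply/clsP.
have [ezc|zc] := eqVneq z c.
  apply: (@step2 c a b y); last by rewrite -ezc; apply/clsP.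
  exact/tri_rot/tri_rot.
have [azb|nzb] := boolP (adj z b); first exact: hit abc azb.
have [azc|nzc] := boolP (adj z c).
  by apply: (hit c b) => //; apply/tri_rot/tri_swap.
apply: (@step2 b c a z); first exact: tri_rot.
by apply/clsP; split; rewrite co_sym; apply: coP.
Qed.

(** * Cross-polytope links for alpha at least 4 *)

Definition perfect (A B : {set G}) :=
  {in A, forall x, exists2 y, y \in B & {in B, forall z, adj x z = (z == y)}}.

(** The link of [c] in H is the boundary of a cross-polytope with opposite facets A and B: matched
    vertices are its antipodal pairs. Independence of B is not included because it comes with the
    rotated triangle. *)
Definition octahedral a b c :=
  [/\ independent (cls b c), #|cls b c| = (alpha G).-1, perfect (cls b c) (cls a c),
      perfect (cls a c) (cls b c) &
      forall x, co c x -> x \in cls b c :|: cls a c].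

Section CrossPolytope.
Variables a b c : G.
Hypotheses (abc : tri a b c) (a3 : 3 < alpha G).
Let A := cls b c.
Let B := cls a c.

Definition linked u r := [&& u \in A, r \in B & co u r].

Let ab : adj a b. Proof. by case/and3P: abc. Qed.
Let bc : adj b c. Proof. by case/and3P: abc. Qed.
Let ca : adj c a. Proof. by case/and3P: abc. Qed.
Let bac : tri b a c. Proof. exact: tri_swap abc. Qed.
Let a1 : 1 < alpha G. Proof. exact: leq_trans a3. Qed.

Let AB x : x \in A -> x \in B -> False.
Proof.
by move=> /clsP[bx cx] /clsP[ax _]; apply: (tri_cover abc (x := x)); rewrite co_sym.
Qed.

Lemma linked_sideB u r : linked u r -> [/\ side b u c \subset B,
  facet (u |: (c |: side b u c)), #|side b u c|.+2 = alpha G & r \in side b u c].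
Proof.
case/and3P=> uA rB ur; have [sB fB] := side_facet abc uA rB ur.
have [[bu cu] [ar cr]] := (clsP _ _ _ uA, clsP _ _ _ rB).
split=> //; first by rewrite -(facet_card fB) card_side // co_sym.
by rewrite inE ur cr (tri_adj abc) // co_sym.
Qed.

Lemma linked_sideA u r : linked u r -> [/\ side a r c \subset A,
  facet (r |: (c |: side a r c)), #|side a r c|.+2 = alpha G & u \in side a r c].
Proof.
case/and3P=> uA rB ur; have ru : co r u by rewrite co_sym.
have [sA fA] := side_facet bac rB uA ru.
have [[bu cu] [ar cr]] := (clsP _ _ _ uA, clsP _ _ _ rB).
split=> //; first by rewrite -(facet_card fA) card_side // co_sym.
by rewrite inE ru cu (tri_adj bac) // co_sym.
Qed.

Lemma mem_sideB u r : u \in A -> r \in B -> (r \in side b u c) = co u r.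
Proof.
by move=> uA /clsP[ar cr]; rewrite inE cr andbT (tri_adj abc) // co_sym.
Qed.

Lemma mem_sideA u r : u \in A -> r \in B -> (u \in side a r c) = co u r.
Proof.
by move=> /clsP[bu cu] rB; rewrite inE cu andbT (tri_adj bac) /= 1?co_sym.
Qed.

Lemma sideB_linked u r r' : linked u r -> r' \in side b u c -> linked u r'.
Proof.
move=> ur r'S; have [sB _ _ _] := linked_sideB ur; have /and3P[uA _ _] := ur.
by rewrite /linked uA (subsetP sB) // -mem_sideB // (subsetP sB).
Qed.

Definition flipped u r x := [&& x \in A, adj r x, co u x &
  [forall r' in side b u c :\ r, co x r']].

Lemma flippedP u r x : flipped u r x ->
  [/\ x \in A, adj r x, co u x & {in side b u c :\ r, forall r', co x r'}].
Proof. by case/and4P=> ? ? ? /forall_inP. Qed.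

(** The flip at [r] of the facet through [u], [c] and [side b u c] lies in A: adjacent to [b], it
    would belong to this side, which is independent and contains [r]. *)
Lemma flipped_ex u r : linked u r -> exists x, flipped u r x.
Proof.
move=> ur; have [sB fB _ rS] := linked_sideB ur; have /and3P[uA rB cour] := ur.
have [bu cu] := clsP _ _ _ uA; have [_ cr] := clsP _ _ _ rB.
have [|x [rx xco _]] := flip fB (v := r); first by rewrite !in_setU1 rS !orbT.
have xu : co x u by apply: xco; rewrite in_setD1 setU11 (co_neq cour).
have xc : co x c.
  by apply: xco; rewrite in_setD1 (co_neq cr) !in_setU1 eqxx orbT.
exists x; apply/and4P; split=> //; last first.
- apply/forall_inP=> r' /setD1P[r'r r'S]; apply: xco.
  by rewrite in_setD1 r'r !in_setU1 r'S !orbT.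
- by rewrite co_sym.
have cx : co c x by rewrite co_sym.
apply/clsP; split=> //; apply: coP.
  by apply: contraTneq xc => <-; rewrite adj_coF.
apply/negP=> bx; have xS : x \in side b u c by rewrite inE bx cx co_sym xu.
have := side_ind c (b := b) (u := u); rewrite co_sym => /(_ bu)/independentP.
by move=> /(_ r x rS xS); rewrite rx.
Qed.

Lemma flipped_neq u r r' x x' : r' \in side b u c -> r' != r ->
  flipped u r x -> flipped u r' x' -> x != x'.
Proof.
move=> r'S ne /flippedP[_ _ _ h] /flippedP[_ r'x' _ _].
by apply: contraTneq r'x' => <-; rewrite adj_sym co_adjF // h // in_setD1 ne.
Qed.

(* For alpha = 4 the two flips x, x' of u could be adjacent, but then G_u would
   have nine vertices, against R(3,4) = 9; concretely, a further vertex y would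
   see an independent set of size four in G_u. *)
Lemma flipped_co4 u r r' x x' : alpha G = 4 -> linked u r ->
  r' \in side b u c -> r' != r -> flipped u r x -> flipped u r' x' -> co x x'.
Proof.
move=> a4 ur r'S r'r fx fx'; have rr' : r != r' by rewrite eq_sym.
have [sB fB cB rS] := linked_sideB ur; have /and3P[uA rB cour] := ur.
have [xA rx ux hx] := flippedP fx; have [x'A r'x' ux' hx'] := flippedP fx'.
have xr' : co x r' by apply: hx; rewrite in_setD1 r'r.
have x'r : co x' r by apply: hx'; rewrite in_setD1 rr'.
have nexx' := flipped_neq r'S r'r fx fx'.
have [bu cu] := clsP _ _ _ uA; have [bx cx] := clsP _ _ _ xA.
have [bx' cx'] := clsP _ _ _ x'A.
have uc : co u c by rewrite co_sym.
have ub : co u b by rewrite co_sym.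
have [ar cr] := clsP _ _ _ rB; have [ar' cr'] := clsP _ _ _ (subsetP sB _ r'S).
have ur' : co u r' by move: r'S; rewrite inE => /and3P[].
apply: coP => //; apply/negP=> xx'.
have eS : side b u c = [set r; r'].
  apply/eqP; rewrite eq_sym eqEcard cards2 rr' /=; apply/andP; split.
    by apply/subsetP=> z /set2P[] ->.
  by rewrite -ltnS -ltnS cB a4.
have fF : facet (x |: (r' |: (u |: [set c]))).
  have h1 : {in [set c], forall z, co u z} by move=> ? /set1P->.
  have h2 : {in u |: [set c], forall z, co r' z}.
    by move=> ? /setU1P[->|/set1P->]; rewrite co_sym.
  have h3 : {in r' |: (u |: [set c]), forall z, co x z}.
    by move=> ? /setU1P[->|/setU1P[->|/set1P->]] //; rewrite co_sym.
  rewrite /facet !cardsU1 cards1 !in_co_notin // a4 andbT.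
  do 3! [apply: independentU1_co => //].
  by apply/independentP=> ? ? /set1P-> /set1P->; rewrite adj_irr.
(* This flip of the facet [x], [r'], [u], [c] is the further vertex. It turns out to be adjacent to
   the two points of [side b u c] and the two of [side c u b], which are therefore independent in
   G_u. *)
have [|y [r'y yco _]] := flip fF (v := r'); first by rewrite !inE eqxx orbT.
have yx : co y x by apply: yco; rewrite !inE eqxx (co_neq xr').
have yu : co y u by apply: yco; rewrite !inE eqxx (co_neq ur') !orbT.
have yc : co y c by apply: yco; rewrite !inE eqxx (co_neq cr') !orbT.
have uy : co u y by rewrite co_sym.
have cy : co c y by rewrite co_sym.
have yA : y \in A.
  apply/clsP; split=> //; apply: coP.
    by apply: contraTneq yc => <-; rewrite adj_coF.
  apply/negP=> by_; have : y \in side b u c by rewrite inE by_ uy cy.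
  rewrite eS => /set2P[] e; last by rewrite e adj_irr in r'y.
  by rewrite e adj_coF in yx.
have yx' : y != x' by apply: contraTneq yx => ->; rewrite co_sym adj_coF.
(* For alpha = 4 a side has two elements, so it has no room for [u], [w] and [y]. *)
have over v e w (S := side a v e) : #|S|.+2 = alpha G -> u \in S -> w \in S ->
    co u w -> y \in S -> y != w -> False.
  rewrite a4 => -[] cS uS wS uw yS yw.
  have /subset_leq_card : u |: (w |: [set y]) \subset S.
    by apply/subsetP=> ? /setU1P[->|/setU1P[->|/set1P->]].
  rewrite cS !cardsU1 cards1 !inE (negbTE (co_neq uw)) (negbTE (co_neq uy)).
  by rewrite eq_sym (negbTE yw).
have yB r0 : r0 \in side b u c -> adj y r0.
  move=> r0S; have ur0 := sideB_linked ur r0S; have r0B := subsetP sB _ r0S.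
  apply: adjP; first by apply/eqP=> e; apply: (AB yA); rewrite e.
  apply/negP=> yr0; have [_ _ cA uS] := linked_sideA ur0.
  have yS : y \in side a r0 c by rewrite mem_sideA.
  move: r0S; rewrite eS => /set2P[] e.
    by apply: (over r0 c x') => //; rewrite mem_sideA // e.
  by apply: (over r0 c x) => //; [rewrite mem_sideA // e | rewrite co_neq].
have [z1 [z1C uz1 _]] := third_cls abc uA rB cour.
have acb : tri a c b by apply/tri_rot/tri_swap.
have uA' : u \in cls c b by rewrite clsC.
have [sC fC] := side_facet acb uA' z1C uz1.
have cC : #|side c u b|.+2 = alpha G by rewrite -(facet_card fC) card_side.
have yC z0 : z0 \in side c u b -> adj y z0.
  move=> z0S; have z0C := subsetP sC _ z0S.
  have uz0 : co u z0 by move: z0S; rewrite inE => /and3P[].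
  have [az0 bz0] := clsP _ _ _ z0C.
  have cab : tri c a b by apply/tri_rot/tri_rot.
  have z0u : co z0 u by rewrite co_sym.
  have [_ fZ] := side_facet cab z0C uA' z0u.
  have cZ : #|side a z0 b|.+2 = alpha G by rewrite -(facet_card fZ) card_side // co_sym.
  have memZ w : w \in A -> co z0 w -> w \in side a z0 b.
    by move=> /clsP[bw cw] zw; rewrite inE zw bw (tri_adj cab) // co_sym.
  apply: adjP.
    by apply: contraTneq uz0 => e; apply/negP=> _; apply: (@tri_cover a b c y);
      rewrite // ?e 1?co_sym // -e.
  apply/negP=> yz0; have z0y : co z0 y by rewrite co_sym.
  have zne w : w \in A -> z0 != w.
    by move=> /clsP[bw cw]; apply/eqP=> e; apply: (@tri_cover a b c w);
      rewrite // co_sym // -e.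
  (* As [x] and [x'] are adjacent in G_u, [z0] misses at least one of them. *)
  have [azx|nzx] := boolP (adj z0 x); last first.
    apply: (over z0 b x) => //; try apply: memZ => //; last exact: co_neq.
    by apply: coP => //; apply: zne.
  apply: (over z0 b x') => //; try apply: memZ => //.
  apply: coP; first exact: zne.
  by rewrite (link_tri uz0 ux ux').
have iBC : independent (side b u c :|: side c u b).
  apply/independentP=> p q; rewrite !(in_setU).
  have iB := independentP _ (side_ind c ub); have iC := independentP _ (side_ind b uc).
  have mix p' q' : p' \in side b u c -> q' \in side c u b -> ~~ adj p' q'.
    move=> pS qS; have [] := (yB _ pS, yC _ qS); rewrite adj_sym => py yq.
    rewrite (@link_tri u p' y q') //.
      by move: pS; rewrite inE => /and3P[].
    by move: qS; rewrite inE => /and3P[].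
  move=> /orP[pS|pS] /orP[qS|qS]; [exact: iB | exact: mix | | exact: iC].
  by rewrite adj_sym mix.
have uBC : {in side b u c :|: side c u b, forall w, co u w}.
  by move=> w; rewrite !inE => /orP[] /and3P[].
have := independent_le_alpha (independentU1_co iBC uBC).
rewrite cardsU1 in_co_notin // cardsU; set I := side b u c :&: _.
have -> : I = set0.
  apply/setP=> w; rewrite !inE; apply/negP=> /andP[/and3P[bw _ _]].
  by case/and3P=> _ _; rewrite adj_coF.
move: cB cC; rewrite a4 => -[->] [->]; by rewrite cards0.
Qed.

(** For alpha above 4 the side has a third element [r2], and both flips lie in the independent set
    [side a r2 c]. *)
Lemma flipped_co u r r' x x' : linked u r ->
  r' \in side b u c -> r' != r -> flipped u r x -> flipped u r' x' -> co x x'.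
Proof.
move=> ur r'S r'r fx fx'.
have := a3; rewrite leq_eqVlt => /orP[/eqP a4|a4]; first exact: flipped_co4 fx fx'.
have [sB _ cB rS] := linked_sideB ur.
have /card_gt0P[r2 /setD1P[r2r' /setD1P[r2r r2S]]] : 0 < #|side b u c :\ r :\ r'|.
  move: a4; rewrite -cB !ltnS (cardsD1 r) rS ltnS (cardsD1 r') in_setD1 r'r r'S.
  exact.
have [xA _ _ hx] := flippedP fx; have [x'A _ _ hx'] := flippedP fx'.
have r2B := subsetP sB _ r2S.
have [ar2 _] := clsP _ _ _ r2B.
apply: (independent_co (side_ind c (u := r2) (b := a) _)).
- by rewrite co_sym.
- by rewrite mem_sideA // hx // in_setD1 r2r.
- by rewrite mem_sideA // hx' // in_setD1 r2r'.
- exact: flipped_neq fx fx'.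
Qed.

Definition flipf u r := odflt u [pick x | flipped u r x].

Lemma flipfP u r : linked u r -> flipped u r (flipf u r).
Proof.
move=> /flipped_ex[x fx]; rewrite /flipf; case: pickP => [//|/(_ x)].
by rewrite fx.
Qed.

(** The candidate for A: [u] and its flips, one for each point of the side. *)
Definition cross u := u |: flipf u @: side b u c.

Lemma flipf_inj u r : linked u r -> {in side b u c &, injective (flipf u)}.
Proof.
move=> ur r1 r2 S1 S2 e; apply/eqP; apply: contraT => ne.
have := flipped_neq S1 ne (flipfP (sideB_linked ur S2)) (flipfP (sideB_linked ur S1)).
by rewrite e eqxx.
Qed.

Lemma cross_co u r : linked u r -> {in flipf u @: side b u c, forall x, co u x}.
Proof.
by move=> ur _ /imsetP[s sS ->]; case/flippedP: (flipfP (sideB_linked ur sS)).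
Qed.

Lemma card_cross u r : linked u r -> #|cross u|.+1 = alpha G.
Proof.
move=> ur; have [_ _ <- _] := linked_sideB ur; rewrite cardsU1.
by rewrite (in_co_notin (cross_co ur)) card_in_imset //; apply: flipf_inj ur.
Qed.

Lemma crossA u r : linked u r -> cross u \subset A.
Proof.
move=> ur; apply/subsetP=> x /setU1P[->|/imsetP[s sS ->]]; first by case/and3P: ur.
by case/flippedP: (flipfP (sideB_linked ur sS)).
Qed.

Lemma cross_facet u r : linked u r -> facet (c |: cross u).
Proof.
move=> ur; have cco : {in cross u, forall x, co c x}.
  by move=> x /(subsetP (crossA ur))/clsP[].
rewrite /facet cardsU1 in_co_notin // add1n (card_cross ur) eqxx andbT.
apply: independentU1_co => //; apply: independentU1_co; last exact: cross_co ur.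
apply/independentP=> _ _ /imsetP[s sS ->] /imsetP[t tS ->].
have [->|st] := eqVneq s t; first by rewrite adj_irr.
rewrite adj_sym co_adjF //.
apply: (flipped_co (sideB_linked ur tS) sS st); apply: flipfP;
  exact: sideB_linked ur _.
Qed.

Lemma sideA_cross u r : linked u r -> side a r c = cross u :\ flipf u r.
Proof.
move=> ur; have [_ _ _ rS] := linked_sideB ur.
have [_ _ cA uS] := linked_sideA ur; have /and3P[uA rB cour] := ur.
have fx := flipfP ur; have [xA rx ux _] := flippedP fx.
apply/eqP; rewrite eq_sym eqEcard; apply/andP; split; last first.
  rewrite -ltnS -ltnS cA -(card_cross ur) (cardsD1 (flipf u r) (cross u)).
  by rewrite in_setU1 imset_f ?orbT.
apply/subsetP=> y /setD1P[yx /setU1P[-> //|/imsetP[s sS ey]]].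
have /flippedP[yA _ _ hy] := flipfP (sideB_linked ur sS).
rewrite ey mem_sideA // hy // in_setD1 rS andbT.
by apply: contraNneq yx => rs; rewrite ey rs.
Qed.

(** Let [x] be the flip at [s], and let [t] be another point of the side, which exists because alpha
    is at least 4. Both crosses consist of [side a t c] and a flip at [t] of the facet through [t],
    [c] and this side; that flip is unique. *)
Lemma cross_const u r x : linked u r -> x \in cross u ->
  (exists s, linked x s) /\ cross x = cross u.
Proof.
move=> ur /setU1P[->|/imsetP[s sS ->]]; first by split; [exists r|].
have us := sideB_linked ur sS; have [xA sx ux hx] := flippedP (flipfP us).
have [sB _ cB _] := linked_sideB ur.
have /card_gt0P[t /setD1P[ts tS]] : 0 < #|side b u c :\ s|.
  by move: a3; rewrite -cB !ltnS (cardsD1 s) sS.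
have ut := sideB_linked ur tS; set x' := flipf u s.
have x't : linked x' t.
  by rewrite /linked xA (subsetP sB) // hx // in_setD1 ts.
split; first by exists t.
have e1 := sideA_cross ut; have e2 := sideA_cross x't.
have [_ fA _ _] := linked_sideA ut.
have mem v : linked v t -> flipf v t \in cross v.
  move=> vt; have [_ _ _ tv] := linked_sideB vt.
  by rewrite in_setU1 imset_f ?orbT.
have tS' : t \in t |: (c |: side a t c) by rewrite setU11.
have ext v : linked v t -> flipf v t != t /\
    {in (t |: (c |: side a t c)) :\ t, forall z, co (flipf v t) z}.
  move=> vt; have fv := cross_facet vt.
  have [vA tv _ _] := flippedP (flipfP vt); split.
    by rewrite eq_sym adj_neq.
  move=> z /setD1P[zt /setU1P[e|zS]]; first by rewrite e eqxx in zt.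
  have mv := mem v vt; have [_ cv] := clsP _ _ _ vA.
  case/setU1P: zS => [->|zS]; first by rewrite co_sym.
  move: zS; rewrite (sideA_cross vt) => /setD1P[zv zS].
  by apply: (facet_co fv); rewrite 1?eq_sym // in_setU1 ?mv ?zS orbT.
have [n1 h1] := ext u ut; have [n2 h2] := ext x' x't.
have e := ridge_uniq a1 fA tS' n2 n1 h2 h1.
by rewrite -(setD1K (mem x' x't)) -(setD1K (mem u ut)) -e1 -e2 e.
Qed.

(** A flip has as partner the point at which it was made. As [y] may be [u] itself, the base point
    is first moved to some other [x] of the cross. *)
Lemma cross_partner u r y : linked u r -> y \in cross u -> exists s,
  [/\ s \in B, adj y s & side a s c = cross u :\ y].
Proof.
move=> ur yU.
have /card_gt0P[x /setD1P[xy xU]] : 0 < #|cross u :\ y|.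
  by have := card_cross ur; rewrite (cardsD1 y) yU => e; move: a3; rewrite -e => /ltnW.
have [[s xs] exu] := cross_const ur xU.
move: yU; rewrite -exu => /setU1P[e|/imsetP[t tS ey]].
  by rewrite e eqxx in xy.
have xt := sideB_linked xs tS; exists t.
have /flippedP[_ ty _ _] := flipfP xt; have /and3P[_ tB _] := xt.
by rewrite (sideA_cross xt) -ey tB adj_sym ey.
Qed.

Lemma linked_octahedral u r : linked u r -> octahedral a b c.
Proof.
move=> ur; set U := cross u; have fU := cross_facet ur.
have UA := subsetP (crossA ur).
pose rho y := odflt y [pick s | [&& s \in B, adj y s & side a s c == U :\ y]].
have rhoP y : y \in U -> [/\ rho y \in B, adj y (rho y) & side a (rho y) c = U :\ y].
  move=> /(cross_partner ur)[s [sB ys es]]; rewrite /rho.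
  case: pickP => [t /and3P[-> -> /eqP->] //|/(_ s)].
  by rewrite sB ys es eqxx.
have rho_co x y : x \in U -> y \in U -> x != y -> co x (rho y).
  move=> xU yU xy; have [rB _ e] := rhoP y yU.
  by rewrite -mem_sideA ?UA // e in_setD1 xy.
have rho_adj x y : x \in U -> y \in U -> adj x (rho y) = (x == y).
  move=> xU yU; have [->|xy] := eqVneq x y; first by case: (rhoP y yU).
  by rewrite co_adjF // rho_co.
have rho_inj : {in U &, injective rho}.
  by move=> x y xU yU e; apply/eqP; rewrite -rho_adj // -e rho_adj.
have cU := card_cross ur; rewrite -/U in cU.
(* [U] has at least three elements, and a third one [z] puts both partners into the independent set
   [side b z c]. *)
have rho_rho x y : x \in U -> y \in U -> x != y -> co (rho x) (rho y).
  move=> xU yU xy.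
  have /card_gt0P[z /setD1P[zy /setD1P[zx zU]]] : 0 < #|U :\ x :\ y|.
    move: a3; rewrite -cU !ltnS (cardsD1 x U) xU ltnS (cardsD1 y) in_setD1 yU eq_sym xy.
    exact.
  have zA := UA z zU; have [bz _] := clsP _ _ _ zA.
  have [xB _ _] := rhoP x xU; have [yB _ _] := rhoP y yU.
  apply: (independent_co (side_ind c (b := b) (u := z) _)).
  - by rewrite co_sym.
  - by rewrite mem_sideB // rho_co.
  - by rewrite mem_sideB // rho_co.
  - by apply: contra_neq xy => /rho_inj; apply.
have cover w : co c w -> w \in U :|: rho @: U.
  move=> cw; rewrite inE; apply: contraT; rewrite negb_or => /andP[wU wR].
  (* From each pair [y], [rho y] take a point that [w] misses: if [w] is adjacent to [y], then, in
     G_c, not to [rho y]. With [c] these points form a facet that [w] would extend. *)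
  pose I := [set x in U | ~~ adj w x].
  pose F := I :|: rho @: (U :\: I).
  have fF : facet (c |: F).
    have IU x : x \in I -> x \in U by rewrite inE => /andP[].
    have cco : {in F, forall x, co c x}.
      move=> x /setUP[/IU/UA/clsP[] //|/imsetP[y /setDP[yU _] ->]].
      by case: (rhoP y yU) => /clsP[].
    rewrite /facet cardsU1 in_co_notin //; apply/andP; split.
      apply: independentU1_co => //; apply/independentP=> x y.
      have UI := independentP _ (facet_ind fU).
      have UU p q : p \in U -> q \in U -> ~~ adj p q.
        by move=> pU qU; apply: UI; rewrite in_setU1 ?pU ?qU orbT.
      move=> /setUP[xI|/imsetP[x' /setDP[xU xI] ->]]
             /setUP[yI|/imsetP[y' /setDP[yU yI] ->]].
      - by apply: UU; apply: IU.
      - by rewrite (rho_adj _ _ (IU _ xI) yU); apply: contraNneq yI => <-.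
      - by rewrite adj_sym (rho_adj _ _ (IU _ yI) xU); apply: contraNneq xI => <-.
      - have [->|ne] := eqVneq x' y'; first by rewrite adj_irr.
        by rewrite co_adjF // rho_rho.
    rewrite -cU cardsU; have -> : I :&: rho @: (U :\: I) = set0.
      apply/setP=> x; rewrite in_setI in_set0; apply/negP=> /andP[/IU/UA xA].
      by case/imsetP=> y /setDP[yU _] ex; case: (rhoP y yU); rewrite -ex => /(AB xA).
    rewrite cards0 subn0 card_in_imset; last first.
      by move=> x y /setDP[xU _] /setDP[yU _]; apply: rho_inj.
    rewrite cardsD (setIidPr _); last by apply/subsetP=> x /IU.
    rewrite subnKC // subset_leq_card //; by apply/subsetP=> x /IU.
  have wUne x : x \in U -> w != x by move=> xU; apply: contraNneq wU => ->.
  have wRne x : x \in U -> w != rho x.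
    by move=> xU; apply: contraNneq wR => ->; apply: imset_f.
  exfalso; apply: (facet_max fF (x := w)) => z /setU1P[->|/setUP[|]].
  - by rewrite co_sym.
  - by case/setIdP=> zU nwz; apply: coP; first exact: wUne.
  - case/imsetP=> y /setDP[yU yI] ->; apply: coP; first exact: wRne.
    have wy : adj w y by apply: contraNT yI => nwy; apply/setIdP.
    have [rB yr _] := rhoP y yU; have [_ cr] := clsP _ _ _ rB.
    by rewrite (@link_tri c w y (rho y)) //; case/clsP: (UA y yU).
have eA : A = U.
  apply/setP=> x; apply/idP/idP=> [xA|/UA //].
  have [_ cx] := clsP _ _ _ xA.
  case/setUP: (cover x cx) => // /imsetP[y yU ex].
  by case: (rhoP y yU); rewrite -ex => /(AB xA).
have eB : B = rho @: U.
  apply/setP=> x; apply/idP/idP=> [xB|/imsetP[y yU ->]]; last by case: (rhoP y yU).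
  have [_ cx] := clsP _ _ _ xB.
  by case/setUP: (cover x cx) => // /UA xA; case: (AB xA xB).
rewrite /octahedral -/A -/B; split.
- by rewrite eA; apply: sub_independent (facet_ind fU); apply: subsetUr.
- by rewrite eA -cU.
- rewrite eA eB => x xU; exists (rho x); first exact: imset_f.
  move=> _ /imsetP[y yU ->]; rewrite rho_adj //.
  by apply/eqP/eqP=> [->|/rho_inj->].
- rewrite eA eB => _ /imsetP[y yU ->]; exists y => // z zU.
  by rewrite adj_sym rho_adj.
- by move=> x cx; rewrite eA eB cover.
Qed.

End CrossPolytope.

(** * Recognising a graph from its adjacency matrix; vertices outside the links *)

Section IsoOfSeq.
Variable s : seq (nat * nat).

(** Only entries above the diagonal are recorded. Non-edges are recorded by [co], which includes
    distinctness, so a correct matrix also shows that the listed vertices are distinct. *)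
Fixpoint row_ok x (i j : nat) (t : seq G) : Prop :=
  if t is y :: t' then
    (if nat_adj s i j then adj x y else co x y) /\ row_ok x i j.+1 t'
  else True.

Fixpoint mat_ok (i : nat) (t : seq G) : Prop :=
  if t is x :: t' then row_ok x i i.+1 t' /\ mat_ok i.+1 t' else True.

Lemma row_okP x0 x i j (t : seq G) k : row_ok x i j t -> k < size t ->
  if nat_adj s i (j + k) then adj x (nth x0 t k) else co x (nth x0 t k).
Proof.
elim: t j k => // y t IH j [|k] /= [h1 h2]; first by rewrite addn0.
by rewrite ltnS addnS -addSn; apply: IH.
Qed.

Lemma mat_okP x0 i (t : seq G) k l : mat_ok i t -> k < l -> l < size t ->
  if nat_adj s (i + k) (i + l) then adj (nth x0 t k) (nth x0 t l)
  else co (nth x0 t k) (nth x0 t l).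
Proof.
elim: t i k l => // x t IH i [|k] [|l] //= [h1 h2] kl lt; last first.
  by rewrite !addnS -!addSn; apply: IH.
by rewrite addn0 addnS -addSn; apply: row_okP.
Qed.

Lemma iso_of_seq x0 (t : seq G) n : mat_ok 0 t -> size t = n -> (forall x, x \in t) ->
  isomorphic G (graph_of_edges n s).
Proof.
move=> ok st memt.
have idx x : index x t < n by rewrite -st index_mem.
pose f x : graph_of_edges n s := Ordinal (idx x).
pose g (i : 'I_n) := nth x0 t i.
have fK : cancel f g by move=> x; rewrite /g nth_index.
have gP (i j : 'I_n) : i < j ->
    if nat_adj s i j then adj (g i) (g j) else co (g i) (g j).
  by move=> ij; apply: (mat_okP x0 ok ij); rewrite st.
have gne (i j : 'I_n) : i < j -> g i != g j.
  by move/gP; case: ifP => _; [apply: adj_neq | apply: co_neq].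
have injg : injective g.
  move=> i j e; apply: val_inj => /=; case: (ltngtP i j) => // /gne.
    by rewrite e eqxx.
  by rewrite e eqxx.
have gadj (i j : 'I_n) : i < j -> adj (g i) (g j) = nat_adj s i j.
  by move/gP; case: ifP => // _ /co_adjF.
exists f; split; first by exists g => //; apply: inj_can_sym injg.
move=> x y; rewrite -[in RHS](fK x) -[in RHS](fK y).
change (adj (f x) (f y)) with (nat_adj s (f x) (f y)).
case: (ltngtP (f x) (f y)) => [lt|lt|/val_inj e]; first by rewrite gadj.
  by rewrite adj_sym gadj // /nat_adj eq_sym orbC.
by rewrite e adj_irr /nat_adj eqxx.
Qed.

End IsoOfSeq.

(** The entries are closed by [auto] from the context; hence the callers first collect a fact or a
    rule for each pair of vertices. *)
Ltac mat_solve :=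
  repeat match goal with
  | |- context [nat_adj ?s ?i ?j] =>
    let v := eval vm_compute in (nat_adj s i j) in change (nat_adj s i j) with v
  end;
  rewrite /mat_ok /row_ok /=; do !split; auto.

(** If some vertex is adjacent to [a], [b] and [c], an H-edge leaves the set of all such vertices.
    Its outer end [w] lies in no class, because its inner end forms a triangle with any two of [a],
    [b], [c]. So only those [w] that miss exactly one of the three are left to the hypothesis. *)
Lemma no_center a b c : ~ is_proper_join G -> tri a b c ->
  (forall u v, adj a u -> adj b u -> adj c u -> co u v -> v \notin cls b c ->
     v \notin cls a c -> v \notin cls a b -> [|| co a v, co b v | co c v] -> False) ->
  forall u, u != a -> u != b -> u != c -> [|| co a u, co b u | co c u].
Proof.
move=> nj abc h u ua ub uc; apply: contraT => nco.
pose D := [set x | [&& adj a x, adj b x & adj c x]].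
have DE v : v != a -> v != b -> v != c ->
    (v \notin D) = [|| co a v, co b v | co c v].
  by move=> va vb vc; rewrite inE /co !negb_and !(eq_sym _ v) va vb vc.
have uD : u \in D by rewrite -[_ \in _]negbK DE // nco.
have aD : a \notin D by rewrite inE adj_irr.
have [v [w [vD wD vw]]] := cut_edge nj uD aD.
have [av bv cv] : [/\ adj a v, adj b v & adj c v].
  by move: vD; rewrite inE => /and3P.
have ne x : adj x v -> w != x.
  by apply: contraTneq => <-; rewrite adj_sym co_adjF.
have hw : [|| co a w, co b w | co c w] by rewrite -DE ?ne.
have /and3P[ab bc ca] := abc.
have wv : co w v by rewrite co_sym.
have out x y : adj x y -> adj x v -> adj y v -> w \notin cls x y.
  move=> xy xv yv; apply/clsP=> -[xw yw].
  by apply: (@tri_cover x y v w); rewrite /tri ?xy ?yv 1?co_sym // adj_sym.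
by exfalso; apply: (h v w); rewrite // out // adj_sym.
Qed.

(** * Three perfect matchings: [Q9] and [Q12] *)

Definition partner (S : {set G}) x := odflt x [pick z in S | adj x z].

Lemma partnerP A B x : perfect A B -> x \in A ->
  [/\ partner B x \in B, adj x (partner B x) &
      {in B, forall z, adj x z = (z == partner B x)}].
Proof.
move=> pAB xA; have [y yB hy] := pAB x xA; rewrite /partner.
have xy : adj x y by rewrite hy.
case: pickP => [z /andP[zB] | /(_ y)]; last by rewrite yB xy.
by move=> xz /=; have := xz; rewrite hy // => /eqP->.
Qed.

Lemma partnerK A B : perfect A B -> perfect B A ->
  {in A, cancel (partner B) (partner A)}.
Proof.
move=> pAB pBA x xA; have [yB xy _] := partnerP pAB xA.
have [_ _ h] := partnerP pBA yB.
by apply/eqP; rewrite eq_sym -h // adj_sym.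
Qed.

Section Matchings.
Variables a b c : G.
Hypotheses (abc : tri a b c) (a2 : 2 < alpha G) (nj : ~ is_proper_join G).
Hypotheses (oC : octahedral a b c) (oA : octahedral b c a) (oB : octahedral c a b).
Let A := cls b c.
Let B := cls c a.
Let C := cls a b.

Let iA : independent A. Proof. by case: oC. Qed.
Let iB : independent B. Proof. by case: oA. Qed.
Let iC : independent C. Proof. by case: oB. Qed.
Let cA : #|A| = (alpha G).-1. Proof. by case: oC. Qed.
Let AB : perfect A B. Proof. by rewrite /B clsC; case: oC. Qed.
Let BA : perfect B A. Proof. by rewrite /B clsC; case: oC. Qed.
Let BC : perfect B C. Proof. by rewrite /C clsC; case: oA. Qed.
Let CB : perfect C B. Proof. by rewrite /C clsC; case: oA. Qed.
Let CA : perfect C A. Proof. by rewrite /A clsC; case: oB. Qed.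
Let AC : perfect A C. Proof. by rewrite /A clsC; case: oB. Qed.

Let neAB x y : x \in A -> y \in B -> x != y.
Proof.
move=> /clsP[bx cx] /clsP[_ ay]; apply/eqP=> e; rewrite -e in ay.
by apply: (tri_cover abc (x := x)); rewrite co_sym.
Qed.
Let neBC x y : x \in B -> y \in C -> x != y.
Proof.
move=> /clsP[cx ax] /clsP[_ by_]; apply/eqP=> e; rewrite -e in by_.
by apply: (tri_cover abc (x := x)); rewrite co_sym.
Qed.
Let neAC x y : x \in A -> y \in C -> x != y.
Proof.
move=> /clsP[bx cx] /clsP[ay _]; apply/eqP=> e; rewrite -e in ay.
by apply: (tri_cover abc (x := x)); rewrite co_sym.
Qed.

(** The path [x], [gam x], [bet x], [nxt x] goes once round the matchings. Labelling C and B by A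
    through [gam] and [bet] turns two of the matchings into identities, and the permutation [nxt]
    alone describes the third. *)
Let gam x := partner C x.
Let bet x := partner B (gam x).
Let nxt x := partner A (bet x).

Let gamC x : x \in A -> gam x \in C.
Proof. by move=> xA; case: (partnerP AC xA). Qed.
Let betB x : x \in A -> bet x \in B.
Proof. by move=> /gamC xC; case: (partnerP CB xC). Qed.
Let nxtA x : x \in A -> nxt x \in A.
Proof. by move=> /betB xB; case: (partnerP BA xB). Qed.

Let adjAC x y : x \in A -> y \in A -> adj x (gam y) = (x == y).
Proof.
move=> xA yA; have [_ _ h] := partnerP CA (gamC yA).
by rewrite adj_sym h // (partnerK AC CA).
Qed.
Let adjBC x y : x \in A -> y \in A -> adj (bet x) (gam y) = (x == y).
Proof.
move=> xA yA; have [_ _ h] := partnerP BC (betB xA).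
rewrite h ?gamC // (partnerK CB BC) ?gamC //.
rewrite (inj_in_eq (can_in_inj (partnerK AC CA))) // eq_sym //.
Qed.
Let adjAB x y : x \in A -> y \in A -> adj x (bet y) = (x == nxt y).
Proof. by move=> xA yA; have [_ _ h] := partnerP BA (betB yA); rewrite adj_sym h. Qed.

Let gam_inj : {in A &, injective gam}.
Proof. exact: can_in_inj (partnerK AC CA). Qed.
Let bet_inj : {in A &, injective bet}.
Proof.
move=> x y xA yA /(can_in_inj (partnerK CB BC) (gamC xA) (gamC yA)).
exact: gam_inj.
Qed.
Let nxt_inj : {in A &, injective nxt}.
Proof.
move=> x y xA yA /(can_in_inj (partnerK BA AB) (betB xA) (betB yA)).
exact: bet_inj.
Qed.

(** At a fixed point [x], [gam x], [bet x] would form a triangle, and [y] misses it. *)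
Let nxt_neq x y : x \in A -> y \in A -> y != x -> nxt x != x.
Proof.
move=> xA yA yx; apply/eqP=> e.
have yco z : y != z -> ~~ adj y z -> co y z by exact: coP.
apply: (@tri_cover x (gam x) (bet x) y).
- by rewrite /tri adjAC // eqxx adj_sym adjBC // eqxx adj_sym adjAB // e eqxx.
- exact: (independent_co iA).
- by rewrite yco ?neAC ?gamC // adjAC.
- by rewrite yco ?neAB ?betB // adjAB // e.
Qed.

Let aA x : x \in A -> adj a x.
Proof. by move=> /clsP[? ?]; apply: (tri_adj (tri_swap abc)); rewrite co_sym. Qed.
Let bB x : x \in B -> adj b x.
Proof. by move=> /clsP[? ?]; apply: (tri_adj abc); rewrite co_sym. Qed.
Let cC x : x \in C -> adj c x.
Proof. by move=> /clsP[? ?]; apply: (tri_adj (tri_rot abc)); rewrite co_sym. Qed.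

Let cover x : [|| x == a, x == b, x == c, x \in A, x \in B | x \in C].
Proof.
have [//|xa] := eqVneq x a; have [//|xb] := eqVneq x b.
have [//|xc] := eqVneq x c.
have cov x' : [|| co a x', co b x' | co c x'] ->
    [|| x' \in A, x' \in B | x' \in C].
  case/or3P=> h.
  - by case: oA => _ _ _ _ /(_ x' h)/setUP[|]; rewrite 1?(clsC b a) => ->; rewrite ?orbT.
  - by case: oB => _ _ _ _ /(_ x' h)/setUP[|]; rewrite 1?(clsC c b) => ->; rewrite ?orbT.
  - by case: oC => _ _ _ _ /(_ x' h)/setUP[|]; rewrite 1?(clsC a c) => ->; rewrite ?orbT.
apply: (cov); apply: (no_center nj abc) => // u v _ _ _ _ vA vB vC /cov.
by rewrite /A /B /C (clsC c a) (negbTE vA) (negbTE vB) (negbTE vC).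
Qed.

Let coverB x : x \in B -> exists2 y, y \in A & x = bet y.
Proof.
move=> xB; have [yC _ _] := partnerP BC xB.
have [zA _ _] := partnerP CA yC.
exists (partner A (partner C x)) => //.
by rewrite /bet /gam (partnerK CA AC) // (partnerK BC CB).
Qed.

Let coverC x : x \in C -> exists2 y, y \in A & x = gam y.
Proof.
move=> xC; have [yA _ _] := partnerP CA xC.
by exists (partner A x) => //; rewrite /gam (partnerK CA AC).
Qed.

Let co_aB x : x \in B -> co a x. Proof. by case/clsP. Qed.
Let co_aC x : x \in C -> co a x. Proof. by case/clsP. Qed.
Let co_bA x : x \in A -> co b x. Proof. by case/clsP. Qed.
Let co_bC x : x \in C -> co b x. Proof. by case/clsP. Qed.
Let co_cA x : x \in A -> co c x. Proof. by case/clsP. Qed.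
Let co_cB x : x \in B -> co c x. Proof. by case/clsP. Qed.
Let co_AA x y : x \in A -> y \in A -> x != y -> co x y.
Proof. exact: (independent_co iA). Qed.
Let co_BB x y : x \in A -> y \in A -> x != y -> co (bet x) (bet y).
Proof.
move=> xA yA xy; apply: (independent_co iB); rewrite ?betB //.
by apply: contra_neq xy; apply: bet_inj.
Qed.
Let co_CC x y : x \in A -> y \in A -> x != y -> co (gam x) (gam y).
Proof.
move=> xA yA xy; apply: (independent_co iC); rewrite ?gamC //.
by apply: contra_neq xy; apply: gam_inj.
Qed.
Let co_AB x y : x \in A -> y \in A -> x != nxt y -> co x (bet y).
Proof. by move=> xA yA xy; rewrite coP ?neAB ?betB // adjAB. Qed.
Let co_AC x y : x \in A -> y \in A -> x != y -> co x (gam y).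
Proof. by move=> xA yA xy; rewrite coP ?neAC ?gamC // adjAC. Qed.
Let co_BC x y : x \in A -> y \in A -> x != y -> co (bet x) (gam y).
Proof. by move=> xA yA xy; rewrite coP ?neBC ?betB ?gamC // adjBC. Qed.
Let adj_AB x y : x \in A -> y \in A -> x = nxt y -> adj x (bet y).
Proof. by move=> xA yA xy; rewrite adjAB // -xy. Qed.
Let adj_AC x : x \in A -> adj x (gam x).
Proof. by move=> xA; rewrite adjAC. Qed.
Let adj_BC x : x \in A -> adj (bet x) (gam x).
Proof. by move=> xA; rewrite adjBC. Qed.

Let two x y : x \in A -> y \in A -> x != y -> A \subset [set x; y] -> isomorphic G Q9.
Proof.
move=> xA yA xy sA; have yx : y != x by rewrite eq_sym.
have mem z : z \in A -> z = x \/ z = y by move/(subsetP sA)/set2P.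
have nx : y = nxt x.
  by have := nxt_neq xA yA yx; case: (mem _ (nxtA xA)) => ->; rewrite ?eqxx.
have ny : x = nxt y.
  by have := nxt_neq yA xA xy; case: (mem _ (nxtA yA)) => ->; rewrite ?eqxx.
have xnx : x != nxt x by rewrite -nx.
have yny : y != nxt y by rewrite -ny.
have /and3P[ab bc ca] := abc; have ac : adj a c by rewrite adj_sym.
apply: (@iso_of_seq _ a [:: a; b; c; x; y; bet x; bet y; gam x; gam y]) => //.
  by mat_solve.
move=> z; case/or4P: (cover z) => [/eqP->|/eqP->|/eqP->|/or3P[/mem[] ->|
  /coverB[w /mem[] -> ->]|/coverC[w /mem[] -> ->]]];
  by rewrite !in_cons eqxx ?orbT.
Qed.

Let three x : x \in A -> #|A| = 3 -> isomorphic G Q12.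
Proof.
move=> xA c3; set z := nxt x; set y := nxt z.
have zA : z \in A by apply: nxtA.
have yA : y \in A by apply: nxtA.
have nn w : w \in A -> nxt w != w.
  move=> wA; have /card_gt0P[v /setD1P[vw vA]] : 0 < #|A :\ w|.
    by move: c3; rewrite (cardsD1 w) wA add1n => -[->].
  exact: nxt_neq vw.
have zx : z != x by apply: nn.
have yz : y != z by apply: nn.
(* If [nxt] exchanged [x] and [z], injectivity would make the third element a fixed point. *)
have yx : y != x.
  apply/eqP=> e.
  have /card_gt0P[w /setD1P[wz /setD1P[wx wA]]] : 0 < #|A :\ x :\ z|.
    by move: c3; rewrite (cardsD1 x) xA (cardsD1 z) in_setD1 zx zA !add1n => -[->].
  have sA : A \subset x |: (z |: [set w]).
    have /eqP -> // : x |: (z |: [set w]) == A.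
    rewrite eqEcard c3 !cardsU1 cards1 !inE !(eq_sym x) (negbTE zx) (negbTE wx).
    rewrite eq_sym (negbTE wz) andbT; apply/subsetP=> v.
    by move=> /setU1P[->|/setU1P[->|/set1P->]].
  have /(subsetP sA)/setU1P[nw|/setU1P[nw|/set1P nw]] := nxtA wA.
  - have : nxt w = nxt z by rewrite nw -/y e.
    by move/(nxt_inj wA zA)/eqP; apply/negP.
  - have : nxt w = nxt x by rewrite nw.
    by move/(nxt_inj wA xA)/eqP; apply/negP.
  - by have := nn w wA; rewrite nw eqxx.
have sA v : v \in A -> [\/ v = x, v = y | v = z].
  have /eqP <- : x |: (y |: [set z]) == A.
    rewrite eqEcard c3 !cardsU1 cards1 !inE !(eq_sym x) (negbTE zx) (negbTE yx).
    rewrite (negbTE yz) andbT; apply/subsetP=> w.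
    by move=> /setU1P[->|/setU1P[->|/set1P->]].
  by move=> /setU1P[|/setU1P[|/set1P]]; [constructor 1|constructor 2|constructor 3].
have ny : x = nxt y.
  have [-> // | e | e] := sA _ (nxtA yA).
    by have := nn y yA; rewrite e eqxx.
  by have := nxt_inj yA xA e; move/eqP; rewrite (negbTE yx).
have [xz zy xy] : [/\ x != z, z != y & x != y] by split; rewrite eq_sym.
have nx : z = nxt x by []. have nz : y = nxt z by [].
have [h1 h2 h3] : [/\ x != nxt x, y != nxt y & z != nxt z].
  by rewrite -nx -ny -nz.
have [h4 h5 h6] : [/\ y != nxt x, z != nxt y & x != nxt z].
  by rewrite -nx -ny -nz.
clearbody z y.
have /and3P[ab bc ca] := abc; have ac : adj a c by rewrite adj_sym.
apply: (@iso_of_seq _ a [:: a; b; c; x; y; z; bet x; bet y; bet z;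
                            gam x; gam y; gam z]) => //.
  by mat_solve.
move=> v; case/or4P: (cover v) => [/eqP->|/eqP->|/eqP->|/or3P[/sA[] ->|
  /coverB[w /sA[] -> ->]|/coverC[w /sA[] -> ->]]];
  by rewrite !in_cons eqxx ?orbT.
Qed.

(* If x, y and their successors are four different elements of A, replacing the
   partners of nxt x and nxt y frees both gam x and gam y. *)
Let four : 3 < #|A| -> False.
Proof.
move=> c4; have [x xA] : exists x, x \in A by apply/card_gt0P; exact: leq_trans c4.
have nn w : w \in A -> nxt w != w.
  move=> wA; have /card_gt0P[v /setD1P[vw vA]] : 0 < #|A :\ w|.
    by move: c4; rewrite (cardsD1 w) wA ltnS => /ltnW/ltnW.
  exact: nxt_neq vw.
have : 1 < #|A :\ x :\ nxt x|.
  by move: c4; rewrite (cardsD1 x) xA (cardsD1 (nxt x)) in_setD1 nn // nxtA.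
move=> /card_gt1P[y1 [y2 [/setD1P[h1 /setD1P[h2 h3]] /setD1P[k1 /setD1P[k2 k3]] y12]]].
(* Of two elements different from [x] and [nxt x], at most one has successor [x]. *)
have [y [yA yx ynx nyx]] :
    exists y, [/\ y \in A, y != x, y != nxt x & nxt y != x].
  have [e|ne] := eqVneq (nxt y1) x; last by exists y1.
  exists y2; split=> //; apply: contra_neq y12 => e2.
  by apply: nxt_inj => //; rewrite e e2.
have nxy : nxt x != nxt y by apply: contra_neq yx => /nxt_inj ->.
pose I := [set nxt x; nxt y]; pose f := partner B.
have IA z : z \in I -> z \in A by case/set2P=> ->; apply: nxtA.
have f_adj p q : p \in A -> q \in A -> adj p (f q) = (p == q).
  move=> pA qA; have [qB _ _] := partnerP AB qA.
  by have [_ _ h] := partnerP BA qB; rewrite adj_sym h // (partnerK AB BA).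
have fB q : q \in A -> f q \in B by move=> qA; case: (partnerP AB qA).
have f_inj : {in A &, injective f} by exact: can_in_inj (partnerK AB BA).
have g_adj p q : p \in A -> q \in A -> adj (gam p) (f q) = (q == nxt p).
  move=> pA qA; have [_ _ h] := partnerP CB (gamC pA); rewrite h ?fB //.
  rewrite -[RHS](inj_in_eq f_inj) ?nxtA // /nxt /f (partnerK BA AB) //.
  exact: betB.
(* In A and B, [gam p] has only the neighbours [p] and [f (nxt p)]. For [p] equal to [x] or [y]
   neither is in [F], which has alpha - 1 elements; adding [gam x] and [gam y] gives alpha + 1. *)
pose F := I :|: f @: (A :\: I).
have cF : #|F| = #|A|.
  rewrite cardsU; have -> : I :&: f @: (A :\: I) = set0.
    apply/setP=> z; rewrite in_setI in_set0; apply/negP=> /andP[/IA zA].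
    by case/imsetP=> q /setDP[qA _] e; have := neAB zA (fB q qA); rewrite e eqxx.
  rewrite cards0 subn0 card_in_imset; last first.
    by move=> p q /setDP[pA _] /setDP[qA _]; apply: f_inj.
  have sI : I \subset A by apply/subsetP=> z /IA.
  by rewrite cardsD (setIidPr sI) subnKC // subset_leq_card.
have iF : independent F.
  apply/independentP=> p q.
  move=> /setUP[pI|/imsetP[p' /setDP[pA pI] ->]]
         /setUP[qI|/imsetP[q' /setDP[qA qI] ->]].
  - by have /independentP := iA; apply; apply: IA.
  - by rewrite f_adj // ?IA //; apply: contraNneq qI => <-.
  - by rewrite adj_sym f_adj // ?IA //; apply: contraNneq pI => <-.
  - by have /independentP := iB; apply; apply: fB.
have gF w : w \in A -> w \notin I -> nxt w \in I -> {in F, forall z, co (gam w) z}.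
  move=> wA wI nwI z /setUP[zI|/imsetP[q /setDP[qA qI] ->]].
    rewrite co_sym; apply: co_AC => //; first exact: IA.
    by apply: contraNneq wI => <-.
  rewrite coP ?g_adj //; last by apply: contraNneq qI => ->.
  by rewrite eq_sym neBC ?fB // gamC.
have xI : x \notin I by rewrite !inE negb_or !(eq_sym x) nn.
have yI : y \notin I by rewrite !inE negb_or ynx eq_sym nn.
have gx := gF x xA xI (set21 _ _); have gy := gF y yA yI (set22 _ _).
have gxy : {in gam y |: F, forall z, co (gam x) z}.
  move=> z /setU1P[->|/gx //]; by apply: co_CC => //; rewrite eq_sym.
have := independent_le_alpha (independentU1_co (independentU1_co iF gy) gxy).
rewrite !cardsU1 !in_co_notin // cF cA; case: (alpha G) a2 => // n _.
by rewrite /= !add1n ltnn.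
Qed.

Lemma octahedral_iso : isomorphic G Q9 \/ isomorphic G Q12.
Proof.
have [x xA] : exists x, x \in A.
  by apply/card_gt0P; rewrite cA; case: (alpha G) a2 => [|[]].
have [c4|] := ltnP 3 #|A|; first by case: (four c4).
rewrite leq_eqVlt => /orP[/eqP c3|]; first by right; apply: three xA c3.
rewrite ltnS => c2; left.
have c2' : #|A| = 2.
  by apply/eqP; rewrite eqn_leq c2 cA; case: (alpha G) a2 => [|[|[]]].
have /card_gt0P[y /setD1P[yx yA]] : 0 < #|A :\ x|.
  by move: c2'; rewrite (cardsD1 x) xA add1n => -[->].
have xy : x != y by rewrite eq_sym.
apply: (two xA yA xy).
have /eqP -> // : A == [set x; y].
rewrite eq_sym eqEcard cards2 xy c2' andbT.
by apply/subsetP=> z /set2P[] ->.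
Qed.

End Matchings.

(** * The case alpha = 3: links are 4-cycles or 5-cycles *)

Section AlphaThree.
Hypothesis a3 : alpha G = 3.

Lemma facet3 x y z : co x y -> co x z -> co y z -> facet (z |: (x |: [set y])).
Proof.
move=> xy xz yz.
have h1 : {in [set y], forall w, co x w} by move=> ? /set1P->.
have h2 : {in x |: [set y], forall w, co z w}.
  by move=> ? /setU1P[->|/set1P->]; rewrite co_sym.
rewrite /facet !cardsU1 cards1 !in_co_notin // a3 andbT.
do 2! [apply: independentU1_co => //].
by apply/independentP=> ? ? /set1P-> /set1P->; rewrite adj_irr.
Qed.

Lemma flip3 x y z : co x y -> co x z -> co y z ->
  exists w, [/\ adj z w, co x w & co y w].
Proof.
move=> xy xz yz; have [|w [zw wco _]] := flip (facet3 xy xz yz) (v := z).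
  by rewrite setU11.
exists w; split=> //; rewrite co_sym; apply: wco.
  by rewrite !inE eqxx (co_neq xz) orbT.
by rewrite !inE eqxx (co_neq yz) !orbT.
Qed.

Lemma third_uniq x y z w v : co x y -> co x z -> co y z -> co x w -> co y w ->
  co x v -> co y v -> z != w -> v = z \/ v = w.
Proof.
move=> xy xz yz xw yw xv yv zw; have [->|vz] := eqVneq v z; [by left | right].
have a1 : 1 < alpha G by rewrite a3.
apply: (ridge_uniq a1 (facet3 xy xz yz) (setU11 _ _) vz); first by rewrite eq_sym.
- move=> t /setD1P[tz /setU1P[e|/setU1P[->|/set1P->]]]; rewrite 1?co_sym //.
  by rewrite e eqxx in tz.
- move=> t /setD1P[tz /setU1P[e|/setU1P[->|/set1P->]]]; rewrite 1?co_sym //.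
  by rewrite e eqxx in tz.
Qed.

(* The two possible shapes of the link of c in the complement: the 4-cycle
   p p2 q2 q and the 5-cycle p p2 t q2 q. *)
Definition sq c p q p2 q2 :=
  co p2 q2 /\ forall v, co c v -> v \in [:: p; p2; q; q2].

Definition pent c p q p2 q2 t :=
  [/\ adj p2 q2, [/\ co c t, co p2 t & co q2 t], adj p t, adj q t &
      forall v, co c v -> v \in [:: p; p2; q; q2; t]].

(** By [third_uniq] every vertex of the link has two H-neighbours in it, and p2, p, q, q2 is a path.
    If the second neighbours [t] of [p2] and [t'] of [q2] differed, [p2], [q], [t'] would be a
    triangle of G_c; a vertex [v] off the cycle would give the triangle [p], [q2], [v]. *)
Lemma link_cycle c p q p2 q2 : co c p -> co c q -> co p q ->
  co c p2 -> co p p2 -> adj q p2 -> co c q2 -> co q q2 -> adj p q2 ->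
  sq c p q p2 q2 \/ exists t, pent c p q p2 q2 t.
Proof.
move=> cp cq pq cp2 pp2 qp2 cq2 qq2 pq2.
have p2p : co p2 p by rewrite co_sym.
have q2q : co q2 q by rewrite co_sym.
have qp : co q p by rewrite co_sym.
have qp2ne : q != p2 := adj_neq qp2.
have pq2ne : p != q2 := adj_neq pq2.
have Ep v : co c v -> co p v -> v = q \/ v = p2.
  by move=> cv pv; apply: (third_uniq cp).
have Eq v : co c v -> co q v -> v = p \/ v = q2.
  by move=> cv qv; apply: (third_uniq cq).
have rest v : co c v -> v \notin [:: p; p2; q; q2] -> adj p v /\ adj q v.
  rewrite !inE !negb_or => cv /and4P[vp vp2 vq vq2].
  split; apply: adjP; rewrite 1?eq_sym //; apply/negP.
    by move/(Ep v cv)=> [] e; rewrite e eqxx in vq vp2.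
  by move/(Eq v cv)=> [] e; rewrite e eqxx in vp vq2.
have ne2 : p2 != q2 by apply: contraTneq pq2 => <-; rewrite co_adjF.
have [cop|nco] := boolP (co p2 q2).
  left; split=> // v cv; apply: contraT => vN; have [pv qv] := rest v cv vN.
  move: vN; rewrite !inE !negb_or => /and4P[vp vp2 vq vq2].
  have [q2v|q2v] := boolP (co q2 v).
    have [] // := third_uniq cq2 cq q2q cp2 _ cv q2v qp2ne; rewrite 1?co_sym //.
      by move=> e; rewrite e eqxx in vq.
    by move=> e; rewrite e eqxx in vp2.
  have aq2v : adj q2 v by apply: adjP; rewrite // eq_sym.
  by have := link_tri cp cq2 cv pq2 aq2v; rewrite pv.
right; have ap2q2 : adj p2 q2 by apply: adjP.
have [t [pt ct p2t]] := flip3 cp2 cp p2p.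
have [t' [qt' ct' q2t']] := flip3 cq2 cq q2q.
have tN : t \notin [:: p; p2; q; q2].
  rewrite !inE !negb_or (eq_sym t p) (adj_neq pt) (eq_sym t p2) (co_neq p2t) /=.
  apply/andP; split; first by apply: contraTneq pt => ->; rewrite co_adjF.
  by apply: contraTneq p2t => ->; rewrite adj_coF.
have [_ qt] := rest t ct tN.
have ett' : t' = t.
  apply/eqP; apply: contraT => tt'.
  have p2t' : adj p2 t'.
    apply: adjP; first by apply: contraTneq q2t' => <-; rewrite co_sym adj_coF.
    apply/negP=> p2t'; have ptne : p != t := adj_neq pt.
    have [] // := third_uniq cp2 cp p2p ct p2t ct' p2t' ptne.
      by move=> e; rewrite e co_sym adj_coF in q2t'.
    by move=> e; rewrite e eqxx in tt'.
  by have := link_tri cp2 cq ct' _ qt'; rewrite p2t' adj_sym => /(_ qp2).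
exists t; split=> //; first by rewrite -ett' in ct p2t *.
move=> v cv; apply: contraT => vN.
have vN' : v \notin [:: p; p2; q; q2].
  by move: vN; rewrite !inE !negb_or => /and5P[-> -> -> ->].
have [pv qv] := rest v cv vN'.
move: vN; rewrite !inE !negb_or => /and5P[vp vp2 vq vq2 vt].
have [q2v|q2v] := boolP (co q2 v).
  have qtne : q != t := adj_neq qt.
  have q2t : co q2 t by rewrite -ett'.
  have [] // := third_uniq cq2 cq q2q ct q2t cv q2v qtne.
    by move=> e; rewrite e eqxx in vq.
  by move=> e; rewrite e eqxx in vt.
have aq2v : adj q2 v by apply: adjP; rewrite // eq_sym.
by have := link_tri cp cq2 cv pq2 aq2v; rewrite pv.
Qed.

(** [p2] is the flip of [q] over the H-edge [c p] and also the flip of [s] over [b p]; likewise for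
    [q2] and [s2]. So the links of [c], [a], [b] contain the paths p2 p q q2, then q2 q s s2, then
    s2 s p p2. *)
Definition conf a b c p q s p2 q2 s2 :=
  [/\ tri a b c,
      [/\ p \in cls b c, q \in cls c a & s \in cls a b],
      [/\ p2 \in cls b c, q2 \in cls c a & s2 \in cls a b],
      [/\ co p q, co q s, co s p, co p p2 & co q q2 /\ co s s2] &
      [/\ adj p q2, adj q p2, adj q s2, adj s q2 & adj s p2 /\ adj p s2]].

Lemma conf_rot a b c p q s p2 q2 s2 :
  conf a b c p q s p2 q2 s2 -> conf b c a q s p q2 s2 p2.
Proof.
case=> t [? ? ?] [? ? ?] [? ? ? ? [? ?]] [? ? ? ? [? ?]].
by split=> //; exact: tri_rot.
Qed.

Lemma conf_swap a b c p q s p2 q2 s2 :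
  conf a b c p q s p2 q2 s2 -> conf b a c q p s q2 p2 s2.
Proof.
case=> t [? ? ?] [? ? ?] [? ? ? ? [? ?]] [? ? ? ? [? ?]].
split; first exact: tri_swap.
- by rewrite (clsC a c) (clsC c b) (clsC b a).
- by rewrite (clsC a c) (clsC c b) (clsC b a).
- by rewrite (co_sym q p) (co_sym p s) (co_sym s q).
- by [].
Qed.

Lemma conf_ex a b c u r : tri a b c -> u \in cls b c -> r \in cls a c -> co u r ->
  exists s p2 q2 s2, conf a b c u r s p2 q2 s2.
Proof.
move=> abc uA rB ur; have [s [sC us rs]] := third_cls abc uA rB ur.
have get a' b' c' u' r' : tri a' b' c' -> u' \in cls b' c' -> r' \in cls a' c' ->
    co u' r' -> exists x, [/\ x \in cls b' c', adj r' x & co u' x].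
  move=> t uA' rB' ur'; have [||x /flippedP[]] := @flipped_ex a' b' c' _ u' r' => //.
    by rewrite /linked uA' rB'.
  by exists x.
have [ru su sr] : [/\ co r u, co s u & co s r] by split; rewrite co_sym.
have [uA' rB' sC'] : [/\ u \in cls c b, r \in cls c a & s \in cls b a].
  by split; rewrite clsC.
have bac := tri_swap abc; have bca := tri_rot abc; have cab := tri_rot bca.
have acb : tri a c b by apply/tri_swap.
have cba : tri c b a by apply/tri_swap.
have [p2 [p2A rp2 up2]] := get a b c u r abc uA rB ur.
have [p2' [p2A' sp2 up2']] := get a c b u s acb uA' sC us.
have [q2 [q2B uq2 rq2]] := get b a c r u bac rB uA ru.
have [q2' [q2B' sq2 rq2']] := get b c a r s bca rB' sC' rs.
have [s2 [s2C us2 ss2]] := get c a b s u cab sC uA' su.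
have [s2' [s2C' rs2 ss2']] := get c b a s r cba sC' rB' sr.
have [[[bu cu] [ar cr]] [as_ bs]] := (clsP _ _ _ uA, clsP _ _ _ rB, clsP _ _ _ sC).
have uniq3 e v w x y : co e v -> co e w -> co v w -> co e x -> co v x ->
    adj w x -> co e y -> co v y -> y != w -> y = x.
  move=> ev ew vw ex vx wx ey vy yw.
  have [e'|//] := third_uniq ev ew vw ex vx ey vy (adj_neq wx).
  by rewrite e' eqxx in yw.
have neA x y : x \in cls b c -> y \in cls c a -> x != y.
  move=> /clsP[bx cx] /clsP[_ ay]; apply/eqP=> e; rewrite -e in ay.
  by apply: (tri_cover abc (x := x)); rewrite co_sym.
have neC x y : x \in cls a b -> y \in cls b c -> x != y.
  move=> /clsP[bx cx] /clsP[_ ay]; apply/eqP=> e; rewrite -e in ay.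
  by apply: (tri_cover abc (x := x)); rewrite co_sym.
(* [p2'] comes from the H-edge [b u] but also completes [c u], whose only completions are [r] and
   [p2]; and [r] lies in another class. *)
have ep : p2' = p2.
  have [] := (clsP _ _ _ p2A, clsP _ _ _ p2A') => -[bp cp] [cp' bp'].
  by apply: (@uniq3 c u r) => //; apply: neA => //; rewrite clsC.
have eq_ : q2' = q2.
  have [] := (clsP _ _ _ q2B, clsP _ _ _ q2B') => -[ap cp] [cp' ap'].
  by apply: (@uniq3 c r u) => //; rewrite eq_sym; apply: neA.
have es : s2' = s2.
  have [] := (clsP _ _ _ s2C, clsP _ _ _ s2C') => -[ap bp] [bp' ap'].
  by apply: (@uniq3 b s u) => //; apply: neC => //; rewrite clsC.
exists s, p2, q2, s2; rewrite ep eq_ es in sp2 sq2 rs2.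
by split=> //; split=> //; rewrite clsC.
Qed.

Section Conf.
Variables a b c p q s p2 q2 s2 : G.
Hypothesis cf : conf a b c p q s p2 q2 s2.

Lemma conf_link : sq c p q p2 q2 \/ exists t, pent c p q p2 q2 t.
Proof.
case: cf => t [pA qB sC] [p2A q2B s2C] [? ? ? ? [? ?]] [? ? ? ? [? ?]].
move: pA qB p2A q2B => /clsP[_ ?] /clsP[? _] /clsP[_ ?] /clsP[? _].
exact: link_cycle.
Qed.

Lemma cls_full u w : u \in cls b c -> adj b w -> adj c w -> adj u w.
Proof.
case: cf => /and3P[_ bc _] _ _ _ _ /clsP[bu cu] bw cw.
apply: adjP; first by apply: contraTneq bw => <-; rewrite co_adjF.
apply/negP=> uw; apply: (@tri_cover b c w u); rewrite // 1?co_sym //.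
by rewrite /tri bc cw adj_sym.
Qed.

End Conf.

(** [w] replaces [c] in the facet [t], [p2], [c]. The path [b], [c], [w] in G_p2 shows that [w]
    misses [b]. It is adjacent to [a], since vertices of [cls a b] are adjacent to [t]. So [w] is
    the fifth vertex of the link of [b]. *)
Lemma pent_next a b c p q s p2 q2 s2 t : conf a b c p q s p2 q2 s2 ->
  pent c p q p2 q2 t -> adj a t -> adj b t ->
  exists w, [/\ pent b s p s2 p2 w, adj a w, adj c w & co t w].
Proof.
move=> cf [_ [ct p2t _] _ _ _] at_ bt.
have [abc [pA qB sC] [p2A q2B s2C] _ _] := cf; have /and3P[ab bc ca] := abc.
have [bp2 cp2] := clsP _ _ _ p2A.
have [[[bp cp] [as_ bs]] [as2 bs2]] := (clsP _ _ _ pA, clsP _ _ _ sC, clsP _ _ _ s2C).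
have [p2c tc tp2] : [/\ co p2 c, co t c & co t p2] by split; rewrite co_sym.
have [w [cw tw p2w]] := flip3 tp2 tc p2c.
have bw : co b w.
  apply: (@link_co p2 b c w) => //; first by rewrite co_sym.
  by apply: contraTneq tw => <-; rewrite co_sym adj_coF.
have aw : adj a w.
  apply: adjP; first by apply: contraTneq tw => <-; rewrite co_sym adj_coF.
  apply/negP=> aw; have wC : w \in cls a b by apply/clsP.
  have := cls_full (conf_rot (conf_rot cf)) wC at_ bt.
  by rewrite adj_sym co_adjF.
have wN : w \notin [:: s; s2; p; p2].
  rewrite !inE !negb_or; apply/and4P; split.
  - by apply: contraTneq aw => ->; rewrite co_adjF.
  - by apply: contraTneq aw => ->; rewrite co_adjF.
  - by apply: contraTneq cw => ->; rewrite co_adjF.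
  - by apply: contraTneq cw => ->; rewrite co_adjF.
have [[_ all]|[t' pt']] := conf_link (conf_rot (conf_rot cf)).
  by rewrite all in wN.
have ew : w = t'.
  case: (pt') => _ _ _ _ /(_ w bw) => wI; move: wI wN; rewrite !inE !negb_or.
  by case/or4P=> [->|->|->|/orP[->|/eqP->]]; rewrite ?andbF.
by exists w; rewrite {1}ew.
Qed.

Lemma pent_swap c p q p2 q2 t : pent c p q p2 q2 t -> pent c q p q2 p2 t.
Proof.
case=> ? [? ? ?] ? ? h; split=> //; first by rewrite adj_sym.
by move=> v /h; rewrite !inE => /or4P[->|->|->|/orP[->|->]]; rewrite ?orbT.
Qed.

(** A 4-cycle is the cross-polytope of this dimension, so three such links reduce to
    [octahedral_iso]. *)
Lemma conf_Q9 a b c p q s p2 q2 s2 : ~ is_proper_join G ->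
  conf a b c p q s p2 q2 s2 -> sq c p q p2 q2 -> sq a q s q2 s2 ->
  sq b s p s2 p2 -> isomorphic G Q9 \/ isomorphic G Q12.
Proof.
have oct a' b' c' p' q' s' p2' q2' s2' : conf a' b' c' p' q' s' p2' q2' s2' ->
    sq c' p' q' p2' q2' -> octahedral a' b' c'.
  move=> [abc [pA qB sC] [p2A q2B s2C] [pq _ _ pp2 [qq2 _]] [pq2 qp2 _ _ _]] [co2 all].
  have neA x : x \in cls b' c' -> x \in cls a' c' -> False.
    move=> /clsP[bx cx] /clsP[ax _].
    by apply: (tri_cover abc (x := x)); rewrite co_sym.
  have qB' : q' \in cls a' c' by rewrite clsC.
  have q2B' : q2' \in cls a' c' by rewrite clsC.
  have eA : cls b' c' = [set p'; p2'].
    apply/setP=> x; rewrite in_set2; apply/idP/orP => [xA|[]/eqP-> //].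
    have [_ cx] := clsP _ _ _ xA.
    move: (all x cx); rewrite !inE => /or4P[|||] h; rewrite ?h; auto.
      by case: (neA x xA); rewrite (eqP h).
    by case: (neA x xA); rewrite (eqP h).
  have eB : cls a' c' = [set q'; q2'].
    apply/setP=> x; rewrite in_set2; apply/idP/orP => [xB|[]/eqP-> //].
    have [_ cx] := clsP _ _ _ xB.
    move: (all x cx); rewrite !inE => /or4P[|||] h; rewrite ?h; auto.
      by case: (neA x) => //; rewrite (eqP h).
    by case: (neA x) => //; rewrite (eqP h).
  have nq : q2' != q' by rewrite eq_sym co_neq.
  have np : p2' != p' by rewrite eq_sym co_neq.
  have [e1 e2 e3 e4] : [/\ adj p' q' = false, adj p' q2' = true,
      adj p2' q' = true & adj p2' q2' = false].
    by split=> //; first [exact: co_adjF | rewrite adj_sym].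
  split.
  - rewrite eA; apply/independentP=> x y /set2P[]-> /set2P[]->; rewrite ?adj_irr //.
      by rewrite co_adjF.
    by rewrite adj_sym co_adjF.
  - by rewrite eA cards2 co_neq // a3.
  - rewrite eA eB => x /set2P[]->; [exists q2' | exists q'];
    rewrite ?in_set2 ?eqxx ?orbT //.
      by move=> z /set2P[]->; rewrite ?e1 ?e2 ?eqxx // eq_sym (negbTE nq).
    by move=> z /set2P[]->; rewrite ?e3 ?e4 ?eqxx ?(negbTE nq).
  - rewrite eA eB => x /set2P[]->; [exists p2' | exists p'];
    rewrite ?in_set2 ?eqxx ?orbT //.
      by move=> z /set2P[]->; rewrite adj_sym ?e1 ?e3 ?eqxx // eq_sym (negbTE np).
    by move=> z /set2P[]->; rewrite adj_sym ?e2 ?e4 ?eqxx ?(negbTE np).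
  - move=> x /all; rewrite eA eB !inE => /or4P[->|->|->|->]; by rewrite ?orbT.
move=> nj cf sc sa sb; have cf' := conf_rot cf; have cf'' := conf_rot cf'.
have [abc _ _ _ _] := cf; have a2 : 2 < alpha G by rewrite a3.
exact: (octahedral_iso abc a2 nj (oct _ _ _ _ _ _ _ _ _ cf sc)
  (oct _ _ _ _ _ _ _ _ _ cf' sa) (oct _ _ _ _ _ _ _ _ _ cf'' sb)).
Qed.

(** [t] misses [b] too and is therefore also the fifth vertex of the link of [b], while the link of
    [a] is a 4-cycle. *)
Lemma conf_P10 a b c p q s p2 q2 s2 t : ~ is_proper_join G ->
  conf a b c p q s p2 q2 s2 -> pent c p q p2 q2 t -> t \in cls b c ->
  isomorphic G P10.
Proof.
move=> nj cf [p2q2 [ct p2t q2t] pt qt allc] tA.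
have [abc [pA qB sC] [p2A q2B s2C] [pq qs sp pp2 [qq2 ss2]]
  [pq2 qp2 qs2 sq2 [sp2 ps2]]] := cf.
have /and3P[ab bc ca] := abc; have ac : adj a c by rewrite adj_sym.
have [[[bp cp] [bp2 cp2]] [bt _]] := (clsP _ _ _ pA, clsP _ _ _ p2A, clsP _ _ _ tA).
have [[cq aq] [cq2 aq2]] := (clsP _ _ _ qB, clsP _ _ _ q2B).
have [[as_ bs] [as2 bs2]] := (clsP _ _ _ sC, clsP _ _ _ s2C).
have neA x y : co b x -> co c x -> co a y -> x != y.
  move=> bx cx; apply: contraTneq => <-; apply/negP=> ax.
  by apply: (tri_cover abc (x := x)); rewrite co_sym.
have aA x : x \in cls b c -> adj a x.
  by move=> /clsP[? ?]; apply: (tri_adj (tri_swap abc)); rewrite co_sym.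
have bB x : x \in cls c a -> adj b x.
  by move=> /clsP[? ?]; apply: (tri_adj abc); rewrite co_sym.
have cC x : x \in cls a b -> adj c x.
  by move=> /clsP[? ?]; apply: (tri_adj (tri_rot abc)); rewrite co_sym.
have cf2 := conf_rot (conf_rot cf).
have tNb : t \notin [:: s; s2; p; p2].
  rewrite !inE !negb_or (eq_sym t p) (adj_neq pt) (eq_sym t p2) (co_neq p2t).
  by rewrite (neA t s) // (neA t s2).
have [[_ allb]|[t' [s2p2 [bt' s2t' p2t'] st' pt' allb]]] := conf_link cf2.
  by rewrite allb in tNb.
have et : t' = t.
  move: (allb t bt) tNb; rewrite !inE !negb_or.
  by case/or4P=> [->|->|->|/orP[->|/eqP->]]; rewrite ?andbF.
rewrite {bt' p2t' pt'}et in s2t' st' allb.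
(* A fifth vertex [w] here would be adjacent to [b] and [c], and [pent_next] would put a vertex
   adjacent to [a] and [b] into the link of [c]; but all five vertices of that link lie in A or
   B. *)
have [[s2q2 alla]|[w pw]] := conf_link (conf_rot cf); last first.
  have [_ [aw _ _] _ _ _] := pw.
  have wN : w \notin [:: q; q2; s; s2].
    case: pw => _ [_ q2w s2w] qw sw _; rewrite !inE !negb_or.
    by rewrite !(eq_sym w) (adj_neq qw) (co_neq q2w) (adj_neq sw) (co_neq s2w).
  have wNp x : x \in cls b c -> w != x.
    by move=> /clsP[bx cx]; rewrite eq_sym neA.
  have cw : adj c w.
    apply: adjP; first by apply: contraTneq aw => <-; rewrite co_sym adj_coF.
    apply/negP=> /allc; rewrite !inE (negbTE (wNp _ pA)) (negbTE (wNp _ p2A)).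
    rewrite (negbTE (wNp _ tA)) orbF /=; move: wN; rewrite !inE !negb_or.
    by move=> /and4P[/negbTE-> /negbTE->].
  have bw : adj b w.
    apply: adjP; first by apply: contraTneq aw => <-; rewrite adj_coF.
    apply/negP=> /allb; rewrite !inE (negbTE (wNp _ pA)) (negbTE (wNp _ p2A)).
    rewrite (negbTE (wNp _ tA)) !orbF /=; move: wN; rewrite !inE !negb_or.
    by move=> /and4P[_ _ /negbTE-> /negbTE->].
  have [v [[_ [cv _ _] _ _ _] bv av _]] := pent_next (conf_rot cf) pw bw cw.
  have := allc v cv; rewrite !inE => /or4P[|||/orP[]] /eqP e.
  - by rewrite e co_adjF in bv.
  - by rewrite e co_adjF in bv.
  - by rewrite e co_adjF in av.
  - by rewrite e co_adjF in av.
  - by rewrite e co_adjF in bv.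
have cover v : [|| co a v, co b v | co c v] ->
    v \in [:: p; t; p2; q; q2; s2; s].
  case/or3P=> [/alla|/allb|/allc]; rewrite !inE.
  - by case/or4P=> ->; rewrite ?orbT.
  - by case/or4P=> [->|->|->|/orP[]->]; rewrite ?orbT.
  - by case/or4P=> [->|->|->|/orP[]->]; rewrite ?orbT.
have ps : co p s by rewrite co_sym.
have [ts ts2] : adj t s /\ co t s2 by rewrite adj_sym co_sym.
have [tq tq2] : adj t q /\ co t q2 by rewrite adj_sym co_sym.
have tp2 : co t p2 by rewrite co_sym.
have [p2q p2s] : adj p2 q /\ adj p2 s by rewrite !(adj_sym p2).
have p2s2 : adj p2 s2 by rewrite adj_sym.
have q2s : adj q2 s by rewrite adj_sym.
have s2s : co s2 s by rewrite co_sym.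
(* After [a], [b], [c] this is the order x, y, a1, b1, b2, c1, c2 of the definition of [P10]. *)
apply: (@iso_of_seq _ a [:: a; b; c; p; t; p2; q; q2; s2; s]) => //.
  by mat_solve.
move=> v; rewrite in_cons; have [//|va] := eqVneq v a.
rewrite in_cons; have [//|vb] := eqVneq v b.
rewrite in_cons; have [//|vc] := eqVneq v c.
apply: (cover); apply: (no_center nj abc) => // u w _ _ _ _.
move=> wA wB wC /cover; rewrite !inE => /or4P[|||/or4P[]] /eqP e.
- by rewrite e pA in wA.
- by rewrite e tA in wA.
- by rewrite e p2A in wA.
- by rewrite e clsC qB in wB.
- by rewrite e clsC q2B in wB.
- by rewrite e s2C in wC.
- by rewrite e sC in wC.
Qed.

(** By [pent_next] all three links are 5-cycles; their fifth vertices [d], [x], [z], for [c], [b],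
    [a], are pairwise H-adjacent. *)
Lemma conf_P12 a b c p q s p2 q2 s2 d : ~ is_proper_join G ->
  conf a b c p q s p2 q2 s2 -> pent c p q p2 q2 d -> adj a d -> adj b d ->
  isomorphic G P12.
Proof.
move=> nj cf pd ad bd.
have [abc [pA qB sC] [p2A q2B s2C] [pq qs sp pp2 [qq2 ss2]]
  [pq2 qp2 qs2 sq2 [sp2 ps2]]] := cf.
have /and3P[ab bc ca] := abc; have ac : adj a c by rewrite adj_sym.
have cfr := conf_rot cf; have cfrr := conf_rot cfr.
have cfs := conf_swap cf.
have [x [px ax cx dx]] := pent_next cf pd ad bd.
have [z [pz bz cz dz]] := pent_next cfs (pent_swap pd) bd ad.
(* [x] and [z] were found from [d] in the two opposite directions. Going on from [x] gives a fifth
   vertex of the link of [a] that misses [x], and it must be [z]. *)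
have xz : co x z.
  have [z' [pz' cz' bz' xz']] := pent_next cfrr px cx ax.
  suff <- : z' = z by [].
  have [_ [az' _ _] _ _ _] := pz'; have [_ _ _ _ h] := pz.
  have := h z' az'; rewrite !inE => /or4P[|||/orP[]] /eqP e //.
  - by rewrite e co_adjF // in bz'; case/clsP: sC.
  - by rewrite e co_adjF // in bz'; case/clsP: s2C.
  - by rewrite e co_adjF // in cz'; case/clsP: qB.
  - by rewrite e co_adjF // in cz'; case/clsP: q2B.
have [p2q2 [cd p2d q2d] pd' qd allc] := pd.
have [s2p2 [bx s2x p2x] sx px' allb] := px.
have [s2q2 [az s2z q2z] sz qz alla] := pz.
have [[bp cp] [bp2 cp2]] := (clsP _ _ _ pA, clsP _ _ _ p2A).
have [[cq aq] [cq2 aq2]] := (clsP _ _ _ qB, clsP _ _ _ q2B).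
have [[as_ bs] [as2 bs2]] := (clsP _ _ _ sC, clsP _ _ _ s2C).
have aA v : v \in cls b c -> adj a v.
  by move=> /clsP[? ?]; apply: (tri_adj (tri_swap abc)); rewrite co_sym.
have bB v : v \in cls c a -> adj b v.
  by move=> /clsP[? ?]; apply: (tri_adj abc); rewrite co_sym.
have cC v : v \in cls a b -> adj c v.
  by move=> /clsP[? ?]; apply: (tri_adj (tri_rot abc)); rewrite co_sym.
have fA v : v \in cls b c -> adj v z by move=> vA; apply: (cls_full cf).
have fB v : v \in cls c a -> adj v x by move=> vB; apply: (cls_full cfr).
have fC v : v \in cls a b -> adj v d by move=> vC; apply: (cls_full cfrr).
have cover v : [|| co a v, co b v | co c v] ->
    v \in [:: d; x; p; z; q; p2; q2; s; s2].
  by case/or3P=> [/alla|/allb|/allc]; rewrite !inE => /or4P[->|->|->|/orP[]->];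
    rewrite ?orbT.
have adjS u v : adj u v -> adj v u by rewrite adj_sym.
have coS u v : co u v -> co v u by rewrite co_sym.
(* Here [p], [q], [p2], [q2], [s], [s2] stand for y, t, a1, b1, c1, c2 of the definition of
   [P12]. *)
apply: (@iso_of_seq _ a [:: a; b; c; d; x; p; z; q; p2; q2; s; s2]) => //.
  by mat_solve.
move=> v; rewrite in_cons; have [//|va] := eqVneq v a.
rewrite in_cons; have [//|vb] := eqVneq v b.
rewrite in_cons; have [//|vc] := eqVneq v c.
apply: (cover); apply: (no_center nj abc) => // u w au bu cu uw.
(* [w] can only be [d], [x] or [z]. It misses two adjacent vertices among [p2], [q2], [s2]; these
   are adjacent to [u] as well, giving a triangle in G_w. *)
have fu e v1 v2 : adj v1 v2 -> co e v1 -> co e v2 -> adj v1 u -> adj v2 u ->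
    co u e -> False.
  move=> v12 ev1 ev2 v1u v2u ue; apply: (@tri_cover v1 v2 u e); rewrite // 1?co_sym //.
  by rewrite /tri v12 v2u adj_sym.
have uA v1 : v1 \in cls b c -> adj v1 u by move=> vA; apply: (cls_full cf).
have uB v1 : v1 \in cls c a -> adj v1 u by move=> vB; apply: (cls_full cfr).
have uC v1 : v1 \in cls a b -> adj v1 u by move=> vC; apply: (cls_full cfrr).
move=> wA wB wC /cover; rewrite !inE => /or4P[|||/or4P[|||/or3P[]]] /eqP e.
- by apply: (fu d p2 q2); rewrite -?e; auto; rewrite e; auto.
- by apply: (fu x s2 p2); rewrite -?e; auto; rewrite e; auto.
- by rewrite e pA in wA.
- by apply: (fu z s2 q2); rewrite -?e; auto; rewrite e; auto.
- by rewrite e clsC qB in wB.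
- by rewrite e p2A in wA.
- by rewrite e clsC q2B in wB.
- by rewrite e sC in wC.
- by rewrite e s2C in wC.
Qed.

Lemma alpha3_classification a b c : ~ is_proper_join G -> tri a b c ->
  isomorphic G Q9 \/ isomorphic G Q12 \/ isomorphic G P10 \/ isomorphic G P12.
Proof.
move=> nj t0; have a2 : 2 < alpha G by rewrite a3.
have {a b c t0} [a [b [c [abc [x xA] [y yB] _]]]] := good_triangle a2 nj t0.
have [u [r [uA rB ur]]] := cls_linked a2 abc xA yB.
have [s [p2 [q2 [s2 cf]]]] := conf_ex abc uA rB ur.
have pentP a' b' c' p q s' p2' q2' s2' : conf a' b' c' p q s' p2' q2' s2' ->
    sq c' p q p2' q2' \/ isomorphic G P10 \/ isomorphic G P12.
  move=> cf'; case: (conf_link cf') => [|[t pt]]; [by left | right].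
  have [abc' _ _ _ _] := cf'; have /and3P[_ bc' ca'] := abc'.
  have [_ [ct _ _] _ _ _] := pt.
  (* The fifth vertex misses [c']. If it also misses [a'] or [b'], it lies in a class and gives
     [P10]; otherwise it gives [P12]. *)
  have [at_|at_] := boolP (adj a' t); last first.
    left; apply: (conf_P10 nj (conf_swap cf') (pent_swap pt)).
    apply/clsP; split=> //; apply: coP => //.
    by apply: contraTneq ct => <-; rewrite adj_coF.
  have [bt|bt] := boolP (adj b' t); first by right; apply: (conf_P12 nj cf' pt).
  left; apply: (conf_P10 nj cf' pt); apply/clsP; split=> //; apply: coP => //.
  by apply: contraTneq ct => <-; rewrite co_sym adj_coF.
have cf' := conf_rot cf; have cf'' := conf_rot cf'.
have [sc|?] := pentP _ _ _ _ _ _ _ _ _ cf; last by right; right.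
have [sa|?] := pentP _ _ _ _ _ _ _ _ _ cf'; last by right; right.
have [sb|?] := pentP _ _ _ _ _ _ _ _ _ cf''; last by right; right.
by case: (conf_Q9 nj cf sc sa sb); [left | right; left].
Qed.

End AlphaThree.

(** * Graphs containing a triangle, and the equivalence *)

Lemma classification a b c : 2 < alpha G -> ~ is_proper_join G -> tri a b c ->
  isomorphic G Q9 \/ isomorphic G Q12 \/ isomorphic G P10 \/ isomorphic G P12.
Proof.
move=> a2 nj t0; have := a2; rewrite leq_eqVlt => /orP[/eqP a3|a3].
  by apply: (alpha3_classification (esym a3) nj t0).
have {a b c t0} [a [b [c [abc [x xA] [y yB] [z zC]]]]] := good_triangle a2 nj t0.
have oct a' b' c' x' y' : tri a' b' c' -> x' \in cls b' c' -> y' \in cls a' c' ->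
    octahedral a' b' c'.
  move=> t xA' yB'; have [u [r [uA rB ur]]] := cls_linked a2 t xA' yB'.
  by apply: (linked_octahedral t a3 (u := u) (r := r)); rewrite /linked uA rB.
have bca := tri_rot abc; have cab := tri_rot bca.
have oC := oct _ _ _ _ _ abc xA yB.
have oA : octahedral b c a by apply: (oct _ _ _ y z bca); rewrite clsC.
have oB : octahedral c a b by apply: (oct _ _ _ z x cab); rewrite // clsC.
by case: (octahedral_iso abc a2 nj oC oA oB); [left | right; left].
Qed.

End LocallyTriangleFreeW2.

Theorem theorem3p6 (G : sgraph)
    (hiso : no_isolated_vertex G)
    (halpha : 3 <= alpha G)
    (hjoin : ~ is_proper_join G) :
  (locally_triangle_free G /\ in_W2 G) <->
  ((triangle_free G /\ in_W2 G) \/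
   (isomorphic G Q9 \/ isomorphic G Q12 \/
    isomorphic G P10 \/ isomorphic G P12)).
Proof.
split=> [[ltf w2]|[[tf w2]|/exceptional_graphs //]]; last first.
  split=> //; apply/locally_triangle_freeP => v x y z _ _ _ _ _ _.
  exact: tf.
have [/existsP[a /existsP[b /existsP[c abc]]]|none] :=
  boolP [exists a : G, exists b : G, exists c : G, tri a b c].
  by right; apply: (classification ltf w2 halpha hjoin abc).
left; split=> // x y z [xy yz zx]; case/negP: none.
apply/existsP; exists x; apply/existsP; exists y; apply/existsP; exists z.
by rewrite /tri xy yz zx.
Qed.
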